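(* Let $1\le m<n$ with $\gcd(n,m)=1$, and consider the generalized Cremmer-Gervais triple $\Gamma_1=\Gamma\setminus\{\alpha_{n-m}\}$, $\Gamma_2=\Gamma\setminus\{\alpha_m\}$, $\tau(\alpha_i)=\alpha_{\mathrm{Res}(i+m)}$. Let $r^0=\sum_{i,j}(r^0)_{ij}^{ij}\,e_{ii}\otimes e_{jj}$ be given by $(r^0)_{ii}^{ii}=0$ and $(r^0)_{ij}^{ij}=\frac12-\frac1n\mathrm{Res}\bigl(\frac{j-i}{m}\bigr)$ for $i\ne j$ (this is the unique solution in $\mathfrak h\wedge\mathfrak h$ of equation ( * ) of the context whose first component has trace zero). Then, for this $r^0$, $$R_{\mathrm{GGS}}=q^{r^0}R_sq^{r^0}+\sum_{\alpha\prec\beta}(q-q^{-1})\,e_{-\alpha}\wedge_{\frac{2O(\alpha,\beta)}{n}}e_\beta .$$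
   Context: Roots and triples. Fix $n\ge2$. Let $(e_i)_{1\le i\le n}$ be the standard basis of $\mathbb C^n$, $(\,,\,)$ the bilinear inner product for which it is orthonormal, $\alpha_i=e_i-e_{i+1}$, $\Gamma=\{\alpha_1,\dots,\alpha_{n-1}\}$. A Belavin-Drinfeld triple of type $A_{n-1}$ is $(\Gamma_1,\Gamma_2,\tau)$ with $\Gamma_1,\Gamma_2\subset\Gamma$ and $\tau:\Gamma_1\to\Gamma_2$ a bijection such that $(\tau\alpha,\tau\beta)=(\alpha,\beta)$ for all $\alpha,\beta\in\Gamma_1$, and for every $\alpha\in\Gamma_1$ there is $k\in\mathbb N$ with $\tau^k\alpha\notin\Gamma_1$. Let $e_{ij}$ be the matrix units. For $\alpha=e_i-e_j$ ($i\ne j$) put $e_\alpha=e_{ij}$, $|\alpha|=|j-i|$, and $\alpha>0$ iff $i<j$. For $Y\subset\Gamma$ let $\tilde Y$ be the set of $v\in\mathrm{Span}(Y)$ of the form $v=e_i-e_j$ with $i<j$. Extend $\tau$ additively to $\tilde\Gamma_1\to\tilde\Gamma_2$. Write $\alpha\prec\beta$ if $\beta=\tau^p\alpha$ for some $p\ge1$; then $O(\alpha,\beta)=p$. If $\alpha\prec\beta=\tau^p\alpha$ with $\alpha=e_j-e_i$, $\beta=e_k-e_{k+i-j}$, $i-j\ge2$, write $\alpha\prec^{\leftarrow}\beta$ if $\tau^p\alpha_j=\alpha_{k+i-j-1}$, and $\alpha\prec^{\rightarrow}\beta$ if $\tau^p\alpha_j=\alpha_k$. Put $\mathrm{sign}(\alpha,\beta)=(-1)^{1-|\alpha|}$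 if $\alpha\prec^{\leftarrow}\beta$, and $\mathrm{sign}(\alpha,\beta)=1$ if $\alpha\prec^{\rightarrow}\beta$ or $|\alpha|=1$. $\mathrm{Res}$ denotes the residue modulo $n$ in $\{1,\dots,n\}$; $\frac{x}{m}$ inside $\mathrm{Res}$ is computed in $\mathbb Z/n$ (where $m$ is invertible). For $c\in\mathbb C$, $e_{-\alpha}\wedge_ce_\beta=q^{-c}e_{-\alpha}\otimes e_\beta-q^ce_\beta\otimes e_{-\alpha}$. The matrix $R_{\mathrm{GGS}}$. Let $\mathfrak h$ be the diagonal matrices, with $e_i(e_{jj})=\delta_{ij}$. Let $P^0=\sum_ie_{ii}\otimes e_{ii}$, $x\wedge y=x\otimes y-y\otimes x$. Equation ( * ) is $$[(\alpha-\tau\alpha)\otimes1]\,r^0=\tfrac12[(\alpha+\tau\alpha)\otimes1]\,P^0\quad\text{for all }\alpha\in\Gamma_1.\qquad( * )$$ Set $q=e^\hbar$ ($\hbar$ formal; $q^x=\exp(\hbar x)$), and $$a=\sum_{\alpha\prec\beta}\mathrm{sign}(\alpha,\beta)\,e_{-\alpha}\wedge e_\beta,\quad r_s=\tfrac12P^0+\sum_{\alpha>0}e_{-\alpha}\otimes e_\alpha,\quad \epsilon=ar_s+r_sa+a^2,$$ $$R_s=q\sum_i e_{ii}\otimes e_{ii}+\sum_{i\ne j}e_{ii}\otimes e_{jj}+(q-q^{-1})\sum_{i>j}e_{ij}\otimes e_{ji}.$$ Writing $z=\sum z_{ik}^{jl}e_{ij}\otimes e_{kl}$, set $\tilde a=\sum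 a_{ik}^{jl}q^{a_{ik}^{jl}\epsilon_{ik}^{jl}}e_{ij}\otimes e_{kl}$, $\bar R_{\mathrm{GGS}}=R_s+(q-q^{-1})\tilde a$ and $R_{\mathrm{GGS}}=q^{r^0}\bar R_{\mathrm{GGS}}q^{r^0}$. *)

(* Defs.v *)
From HB Require Import structures.
From mathcomp Require Import all_boot all_order all_algebra.
From mathcomp Require Import mxtens complex ring zify.
From mathcomp Require Import boolp classical_sets reals.

Set Implicit Arguments.
Unset Strict Implicit.
Unset Printing Implicit Defensive.

Import Order.TTheory GRing.Theory Num.Theory.

Local Open Scope ring_scope.

(* Formal power series in one variable hbar.  The wrapper keeps the Cauchy    *)
(* product apart from the pointwise product of functions.                     *)
Record fps (A : Type) := Fps { coefs : nat -> A }.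

HB.instance Definition _ (A : Type) := [isNew for @coefs A].
HB.instance Definition _ (A : choiceType) := [Choice of fps A by <:].

Section FpsRing.
Variable A : comNzRingType.
Implicit Types f g h : fps A.

Lemma fpsP f g : (forall k, coefs f k = coefs g k) -> f = g.
Proof. by case: f g => [u] [v] /= /funext ->. Qed.

Definition fps_const (c : A) : fps A := Fps (fun k => if k is 0 then c else 0).
Definition fps_add f g : fps A := Fps (fun k => coefs f k + coefs g k).
Definition fps_opp f : fps A := Fps (fun k => - coefs f k).
Definition fps_mul f g : fps A :=
  Fps (fun k => \sum_(i < k.+1) coefs f i * coefs g (k - i)%N).

Lemma fps_addA : associative fps_add.
Proof. by move=> f g h; apply: fpsP => k /=; rewrite addrA. Qed.
Lemma fps_addC : commutative fps_add.
Proof. by move=> f g; apply: fpsP => k /=; rewrite addrC. Qed.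
Lemma fps_add0 : left_id (fps_const 0) fps_add.
Proof. by move=> f; apply: fpsP => -[|k] /=; rewrite add0r. Qed.
Lemma fps_addN : left_inverse (fps_const 0) fps_opp fps_add.
Proof. by move=> f; apply: fpsP => -[|k] /=; rewrite addNr. Qed.

HB.instance Definition _ :=
  GRing.isZmodule.Build (fps A) fps_addA fps_addC fps_add0 fps_addN.

Let trunc N f : {poly A} := \poly_(i < N) coefs f i.

Lemma fps_mul_trunc N f g k : (k < N)%N ->
  coefs (fps_mul f g) k = (trunc N f * trunc N g)`_k.
Proof.
move=> ltkN; rewrite coefM /=; apply: eq_bigr => i _.
have lei : (i <= k)%N by rewrite -ltnS.
by rewrite !coef_poly (leq_ltn_trans lei ltkN) (leq_ltn_trans (leq_subr _ _) ltkN).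
Qed.

Lemma fps_mulC : commutative fps_mul.
Proof.
by move=> f g; apply: fpsP => k; rewrite !(fps_mul_trunc _ _ (ltnSn k)) mulrC.
Qed.

Lemma fps_mulA : associative fps_mul.
Proof.
have key f g h k : coefs (fps_mul (fps_mul f g) h) k =
    (trunc k.+1 f * trunc k.+1 g * trunc k.+1 h)`_k.
  rewrite (fps_mul_trunc _ _ (ltnSn k)) !coefM; apply: eq_bigr => i _.
  by rewrite coef_poly ltn_ord (fps_mul_trunc _ _ (ltn_ord i)).
move=> f g h; apply: fpsP => k.
by rewrite fps_mulC !key mulrC mulrA.
Qed.

Lemma fps_mul1 : left_id (fps_const 1) fps_mul.
Proof.
move=> f; apply: fpsP => k /=.
rewrite big_ord_recl /= mul1r subn0 big1 ?addr0 // => i _.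
by rewrite mul0r.
Qed.

Lemma fps_mulDl : left_distributive fps_mul fps_add.
Proof.
move=> f g h; apply: fpsP => k /=; rewrite -big_split /=.
by apply: eq_bigr => i _; rewrite mulrDl.
Qed.

Lemma fps_1neq0 : fps_const 1 != 0.
Proof.
by apply/eqP => /(congr1 (fun f => coefs f 0%N)) /eqP /=; rewrite oner_eq0.
Qed.

HB.instance Definition _ := GRing.Zmodule_isComNzRing.Build (fps A)
  fps_mulA fps_mulC fps_mul1 fps_mulDl fps_1neq0.

End FpsRing.

Section Exponentials.
Variable C : fieldType.

(* q^x = exp (hbar x) *)
Definition qpow (x : C) : fps C := Fps (fun k => x ^+ k / (k`!)%:R).

(* q^A = exp (hbar A) for a square matrix A *)
Definition qpow_mx d (A : 'M[C]_d) : 'M[fps C]_d :=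
  \matrix_(i, j) Fps (fun k => (A ^+ k) i j / (k`!)%:R).

End Exponentials.

(* Tensors: End(C^n) ⊗ End(C^n) is 'M_(n * n), with x ⊗ y = x *t y; the       *)
(* coefficient z_{ik}^{jl} of e_ij ⊗ e_kl in z is the entry                   *)
(* z (mxtens_index (i, k)) (mxtens_index (j, l)).                             *)
Section Tensors.
Variables (A : comPzRingType) (n : nat).

Definition wedge (x y : 'M[A]_n) : 'M[A]_(n * n) := x *t y - y *t x.

Definition P0 : 'M[A]_(n * n) :=
  \sum_(i < n) (delta_mx i i : 'M[A]_n) *t (delta_mx i i : 'M[A]_n).

(* (f ⊗ 1) z for z in h ⊗ h, where f in h^* takes the value f 0 i at e_ii.    *)
Definition contract1 (f : 'rV[A]_n) (z : 'M[A]_(n * n)) : 'M[A]_n :=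
  \matrix_(k, l) \sum_(i < n)
     f 0 i * z (mxtens_index (i, k)) (mxtens_index (i, l)).

Definition in_h_wedge_h (z : 'M[A]_(n * n)) : Prop :=
  exists c : 'M[A]_n,
    z = \sum_(i < n) \sum_(j < n) c i j *: wedge (delta_mx i i) (delta_mx j j).

End Tensors.

(* The pair (i, j) with i != j stands for the root e_i - e_j.  Ordinals start *)
(* at 0, so the i : 'I_n is the index i.+1 of the usual numbering from 1 to n.*)
Definition rootidx (n : nat) := ('I_n * 'I_n)%type.

Definition rpos n (a : rootidx n) : bool := (a.1 < a.2)%N.

Definition rheight n (a : rootidx n) : nat := `|(a.2 : int) - (a.1 : int)|%N.

Definition simple_roots n : {set rootidx n} :=
  [set a : rootidx n | a.2 == a.1.+1 :> nat].

(* For a in simple_roots n, a is alpha_i with i = label a (1 <= i <= n - 1).  *)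
Definition label n (a : rootidx n) : nat := a.1.+1.

Section Roots.
Variables (C : fieldType) (n : nat).
Implicit Types a b : rootidx n.

Definition rvec a : 'rV[C]_n := delta_mx 0 a.1 - delta_mx 0 a.2.

Definition inner (u v : 'rV[C]_n) : C := \sum_(i < n) u 0 i * v 0 i.

Definition e_pos (A : pzRingType) a : 'M[A]_n := delta_mx a.1 a.2.
Definition e_neg (A : pzRingType) a : 'M[A]_n := delta_mx a.2 a.1.

(* Only the values of BDtau on BD1 matter.                                    *)
Record BDtriple := MkBDtriple {
  BD1 : {set rootidx n};
  BD2 : {set rootidx n};
  BDtau : rootidx n -> rootidx n;
  BD1_sub : BD1 \subset simple_roots n;
  BD2_sub : BD2 \subset simple_roots n;
  BDtau_inj : {in BD1 &, injective BDtau};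
  BDtau_img : BDtau @: BD1 = BD2;
  BDtau_isom : {in BD1 &, forall a b,
    inner (rvec (BDtau a)) (rvec (BDtau b)) = inner (rvec a) (rvec b)};
  BDtau_nilp : {in BD1, forall a, exists k, iter k BDtau a \notin BD1}
}.

Definition tilde (Y : {set rootidx n}) : {set rootidx n} :=
  [set a | rpos a && (rvec a \in <<[seq rvec g | g in Y]>>%VS)].

Section Triple.
Variable T : BDtriple.

(* Additive extension of tau: a root e_i - e_j with i < j is the sum of the   *)
(* simple roots e_s - e_(s+1), i <= s < j.                                    *)
Definition tau_ext a : option (rootidx n) :=
  if a \in tilde (BD1 T) then
    [pick b in tilde (BD2 T) | rvec b ==
       \sum_(g in simple_roots n | (a.1 <= g.1 < a.2)%N) rvec (BDtau T g)]
  else None.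

Definition tau_pow (p : nat) a : option (rootidx n) :=
  iter p (obind tau_ext) (Some a).

Definition prec a b : bool :=
  `[< exists p, (0 < p)%N /\ tau_pow p a = Some b >].

(* The exponent is unique when prec a b holds, as tau is nilpotent.           *)
Definition ordO a b : nat :=
  xget 0%N [set p | (0 < p)%N /\ tau_pow p a = Some b].

(* g is the first simple root of a; h is the last (resp. first) one of b.     *)
Definition prec_left a b : bool :=
  [&& prec a b, (2 <= rheight a)%N &
    [exists g in simple_roots n, [exists h in simple_roots n,
      [&& g.1 == a.1, h.2 == b.2 & tau_pow (ordO a b) g == Some h]]]].
Definition prec_right a b : bool :=
  [&& prec a b, (2 <= rheight a)%N &
    [exists g in simple_roots n, [exists h in simple_roots n,
      [&& g.1 == a.1, h.1 == b.1 & tau_pow (ordO a b) g == Some h]]]].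

(* The last case does not occur when prec a b holds.                          *)
Definition rsign a b : C :=
  if prec_left a b then (-1) ^ (1 - (rheight a)%:Z)
  else if prec_right a b || (rheight a == 1%N) then 1
  else 0.

Definition r0_equation (r0 : 'M[C]_(n * n)) : Prop :=
  forall a, a \in BD1 T ->
    contract1 (rvec a - rvec (BDtau T a)) r0 =
    2^-1 *: contract1 (rvec a + rvec (BDtau T a)) (P0 C n).

(* Solutions in h /\ h with first component of trace zero: (tr ⊗ 1) r0 = 0.   *)
Definition r0_solution (r0 : 'M[C]_(n * n)) : Prop :=
  [/\ in_h_wedge_h r0, r0_equation r0 & contract1 (const_mx 1) r0 = 0].

Definition ggs_a : 'M[C]_(n * n) :=
  \sum_(ab : rootidx n * rootidx n | prec ab.1 ab.2)
    rsign ab.1 ab.2 *: wedge (e_neg C ab.1) (e_pos C ab.2).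

Definition ggs_rs : 'M[C]_(n * n) :=
  2^-1 *: P0 C n + \sum_(a : rootidx n | rpos a) e_neg C a *t e_pos C a.

Definition ggs_eps : 'M[C]_(n * n) :=
  ggs_a *m ggs_rs + ggs_rs *m ggs_a + ggs_a *m ggs_a.

Definition ggs_atilde : 'M[fps C]_(n * n) :=
  \matrix_(I, J) (fps_const (ggs_a I J) * qpow (ggs_a I J * ggs_eps I J)).

(* q - q^-1 *)
Definition qdiff : fps C := qpow 1 - qpow (-1).

Definition R_s : 'M[fps C]_(n * n) :=
  let e i j : 'M[fps C]_n := delta_mx i j in
  qpow 1 *: (\sum_(i < n) e i i *t e i i)
  + \sum_(i < n) \sum_(j < n | i != j) e i i *t e j j
  + qdiff *: (\sum_(i < n) \sum_(j < n | (j < i)%N) e i j *t e j i).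

Definition R_GGS (r0 : 'M[C]_(n * n)) : 'M[fps C]_(n * n) :=
  qpow_mx r0 *m (R_s + qdiff *: ggs_atilde) *m qpow_mx r0.

(* e_{-a} wedge_c e_b *)
Definition qwedge (c : C) a b : 'M[fps C]_(n * n) :=
  qpow (- c) *: (e_neg _ a *t e_pos _ b) - qpow c *: (e_pos _ b *t e_neg _ a).

End Triple.
End Roots.

(* Residue modulo n in {1, ..., n}; used only for n >= 2, where 'Z_n is Z/n.  *)
Definition Res n (x : 'Z_n) : nat := if x == 0 then n else x.
Arguments Res : clear implicits.

Section CremmerGervais.
Variables (C : fieldType) (n m : nat).

Definition CG1 : {set rootidx n} :=
  [set a in simple_roots n | label a != (n - m)%N].
Definition CG2 : {set rootidx n} := [set a in simple_roots n | label a != m].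
Definition CGtau (a : rootidx n) : rootidx n :=
  odflt a [pick b in simple_roots n | label b == Res n (label a + m)%:R].

Hypotheses (m_gt0 : (0 < m)%N) (ltmn : (m < n)%N) (conm : coprime n m).

Let n_gt1 : (1 < n)%N. Proof. exact: leq_ltn_trans ltmn. Qed.

Lemma label_inj : {in simple_roots n &, injective (@label n)}.
Proof.
move=> [a1 a2] [b1 b2]; rewrite !inE /= => /eqP ea /eqP eb [] e1.
by congr (_, _); apply: val_inj => //=; rewrite ea eb e1.
Qed.

Lemma label_bound a : a \in simple_roots n -> (label a < n)%N.
Proof. by rewrite inE => /eqP ea; rewrite /label -ea. Qed.

Lemma label_ex l : (0 < l < n)%N -> exists2 a, a \in simple_roots n & label a = l.
Proof.
case: l => // l /= ltn; exists (Ordinal (ltnW ltn), Ordinal ltn) => //.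
by rewrite inE.
Qed.

Lemma Res_nat k : Res n (k%:R : 'Z_n) = if (k %% n)%N is 0 then n else (k %% n)%N.
Proof.
have e : ((k%:R : 'Z_n) : nat) = (k %% n)%N by rewrite val_Zp_nat.
rewrite /Res -val_eqE /= e; by case: (k %% n)%N.
Qed.

Lemma CG_mod a : a \in CG1 -> ((label a + m) %% n != 0)%N.
Proof.
rewrite inE => /andP[/label_bound lt /eqP ne]; apply/negP => /dvdnP[[|[|q]]].
- by rewrite mul0n addnC; case: (m) m_gt0.
- by rewrite mul1n => e; apply: ne; lia.
- by rewrite !mulSn; lia.
Qed.

Lemma CGtauP a : a \in CG1 ->
  CGtau a \in simple_roots n /\ label (CGtau a) = ((label a + m) %% n)%N.
Proof.
move=> a1; have nz := CG_mod a1.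
have eR : Res n ((label a + m)%:R : 'Z_n) = ((label a + m) %% n)%N.
  by rewrite Res_nat; case: (_ %% _)%N nz.
rewrite /CGtau eR; case: pickP => [b /andP[bS /eqP bl]|no] //=.
have [|b bS bl] := @label_ex ((label a + m) %% n)%N.
  by rewrite lt0n nz ltn_mod (ltnW n_gt1).
by have := no b; rewrite bS bl eqxx.
Qed.

Lemma CG1_sub : CG1 \subset simple_roots n.
Proof. by apply/fintype.subsetP => a; rewrite inE => /andP[]. Qed.
Lemma CG2_sub : CG2 \subset simple_roots n.
Proof. by apply/fintype.subsetP => a; rewrite inE => /andP[]. Qed.

Lemma CGtau_inj : {in CG1 &, injective CGtau}.
Proof.
move=> a b a1 b1 e; have [_ ea] := CGtauP a1; have [_ eb] := CGtauP b1.
have aS := fintype.subsetP CG1_sub _ a1; have bS := fintype.subsetP CG1_sub _ b1.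
apply: label_inj => //; move: ea; rewrite e eb => /eqP.
by rewrite eqn_modDr !modn_small ?label_bound // => /eqP.
Qed.

Lemma CGtau_img : CGtau @: CG1 = CG2.
Proof.
apply/setP => b; apply/imsetP/idP => [[a a1 ->]|].
  have [tS tl] := CGtauP a1; rewrite inE tS tl /=; apply/eqP => /esym e.
  move: a1; rewrite inE => /andP[/label_bound lt _].
  have /eqP : (0 + m = label a + m %[mod n])%N by rewrite -e modn_small // modn_small.
  by rewrite eqn_modDr mod0n modn_small.
rewrite inE => /andP[bS /eqP bm]; have blt := label_bound bS.
have key : (((label b + (n - m)) %% n + m) %% n = label b)%N.
  by rewrite modnDml -addnA subnK 1?ltnW // modnDr modn_small.
have [|a aS al] := @label_ex ((label b + (n - m)) %% n)%N.
  rewrite ltn_mod (ltnW n_gt1) andbT lt0n; apply/eqP => e.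
  by apply: bm; rewrite -key e add0n modn_small.
have a1 : a \in CG1.
  rewrite inE aS al /=; apply/eqP => e; move: key; rewrite e subnK 1?ltnW //.
  by rewrite modnn.
exists a => //; have [tS tl] := CGtauP a1.
by apply: label_inj => //; rewrite tl al key.
Qed.

Lemma inner_simple a b : a \in simple_roots n -> b \in simple_roots n ->
  inner (rvec C a) (rvec C b) =
    (label a == label b)%:R *+ 2 - (label a == (label b).+1)%:R
      - (label b == (label a).+1)%:R.
Proof.
case: a b => [a1 a2] [b1 b2]; rewrite !inE /inner /rvec /label /= => /eqP ea /eqP eb.
pose D (i k : 'I_n) : C := (k == i)%:R.
have dd (i j : 'I_n) : \sum_(k < n) D i k * D j k = (i == j)%:R.
  rewrite (bigD1 i) //= /D eqxx mul1r big1 ?addr0 // => k /negbTE ->.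
  by rewrite mul0r.
rewrite (eq_bigr (fun k => D a1 k * D b1 k + D a2 k * D b2 k
    - D a1 k * D b2 k - D a2 k * D b1 k)); last first.
  by move=> k _; rewrite !mxE !eqxx /= /D; ring.
rewrite !big_split /= !sumrN !dd -!val_eqE /= ea eb !eqSS mulr2n.
by rewrite [(b1 : nat) == _]eq_sym; ring.
Qed.

Lemma CGtau_isom : {in CG1 &, forall a b,
  inner (rvec C (CGtau a)) (rvec C (CGtau b)) = inner (rvec C a) (rvec C b)}.
Proof.
have adj x y : x \in CG1 -> y \in CG1 ->
    (label (CGtau x) == (label (CGtau y)).+1) = (label x == (label y).+1).
  move=> x1 y1; have [xS xl] := CGtauP x1; have [yS yl] := CGtauP y1.
  have xb := label_bound xS; have yb := label_bound yS.
  have xlt := label_bound (fintype.subsetP CG1_sub _ x1).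
  have ylt := label_bound (fintype.subsetP CG1_sub _ y1).
  have nz := CG_mod x1.
  have es : ((label y).+1 + m = (label (CGtau y)).+1 %[mod n])%N.
    by rewrite yl -addn1 -[in RHS]addn1 modnDml addnAC.
  apply/eqP/eqP => e.
  - have /eqP : (label x + m = (label y).+1 + m %[mod n])%N.
      by rewrite es -e xl modn_mod.
    rewrite eqn_modDr modn_small // => /eqP.
    move: ylt; rewrite leq_eqVlt => /orP[/eqP ->|lt]; last by rewrite modn_small.
    by rewrite modnn.
  - rewrite xl e es; move: yb; rewrite leq_eqVlt => /orP[/eqP ey|lt].
      by move: nz; rewrite e es ey modnn.
    by rewrite modn_small.
move=> a b a1 b1; have [aS _] := CGtauP a1; have [bS _] := CGtauP b1.
have aS0 := fintype.subsetP CG1_sub _ a1; have bS0 := fintype.subsetP CG1_sub _ b1.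
rewrite !inner_simple // !adj //.
have -> // : (label (CGtau a) == label (CGtau b)) = (label a == label b).
apply/eqP/eqP => [/(label_inj aS bS)|/(label_inj aS0 bS0) -> //].
by move=> /CGtau_inj ->.
Qed.

Lemma CGtau_nilp : {in CG1, forall a, exists k, iter k CGtau a \notin CG1}.
Proof.
move=> a a1; apply: contrapT => no.
have H k : iter k CGtau a \in CG1.
  by apply: contrapT => nk; apply: no; exists k; apply/negP.
have lab k : (label (iter k CGtau a) = label a + k * m %[mod n])%N.
  elim: k => [|k IH]; first by rewrite mul0n addn0.
  have [_ e] := CGtauP (H k).
  by rewrite iterS e modn_mod -modnDml IH modnDml mulSn addnCA addnC addnA addnAC.
have alt := label_bound (fintype.subsetP CG1_sub _ a1).
have [u v uv _] := egcdnP n m_gt0.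
have g1 : gcdn m n = 1%N by rewrite gcdnC; apply/eqP.
pose k := (u * (n - label a) + n.-1)%N.
have /eqP[] := CG_mod (H k).
rewrite -modnDml lab modnDml.
have -> : (label a + k * m + m = label a + (u * m) * (n - label a) + m * n)%N.
  by rewrite /k; nia.
have -> : (label a + (u * m) * (n - label a) + m * n =
           ((n - label a) * v + m + 1) * n)%N.
  by rewrite uv g1; nia.
by rewrite modnMl.
Qed.

Definition CG_triple : BDtriple C n := MkBDtriple
  CG1_sub CG2_sub CGtau_inj CGtau_img CGtau_isom CGtau_nilp.

Definition CG_r0 : 'M[C]_(n * n) :=
  \sum_(i < n) \sum_(j < n)
    (if i == j then 0
     else 2^-1 - n%:R^-1 * (Res n ((j%:R - i%:R) / m%:R))%:R) *:
    (delta_mx i i *t delta_mx j j).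

End CremmerGervais.

(* Main.v *)
Require Import Defs.
From mathcomp Require Import all_boot all_order all_algebra.
From mathcomp Require Import mxtens complex ring zify.
From mathcomp Require Import boolp classical_sets reals.

(* On indices, tau is the rotation v |-> v + m mod n, so alpha = e_i - e_j     *)
(* precedes beta = e_k - e_l with O(alpha, beta) = p iff k = i + pm mod n and  *)
(* i + tm mod n stays below n - (j - i) for all t <= p; no sign ever occurs.   *)
(* Everything reduces to the coefficient of epsilon at e_ji (x) e_kl.  Let s   *)
(* be the number of steps from i to j.  Adding up the exponents of q, one has  *)
(* to show that this coefficient is                                            *)
(*   - [p > s] - [p = s] / 2 - [p + s > n] - [p + s = n] / 2.                  *)
(* The halves come from the diagonal part of r_s.  The rest is a count: the    *)
(* pairs (x, y) with x + y = j + k contribute to a^2 with the signs            *)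
(*   +  if (x,j) < (k,y) and (i,x) < (y,l),                                    *)
(*   -  if (y,k) < (j,x) and (i,x) < (y,l),                                    *)
(*   -  if (x,j) < (k,y) and (l,y) < (x,i).                                    *)
(* Write q for the number of steps from i to y, and let W be the set of q such *)
(* that y < l and (i, i + l - y) < (y, l).  The positive pairs with q > p are  *)
(* the q in W with max(p, s) < q < p + s, the pairs of the second kind are the *)
(* q with q + s in W, 0 < q < s and q < p, and W is invariant under q |-> q + s*)
(* for s < q < p; so these numbers differ by [p > s] up to the boundary term   *)
(* q = s.  The mirror image v |-> n - 1 - v, m |-> n - m matches the positive  *)
(* pairs with q < p and the pairs of the third kind, which gives [p + s > n].  *)
(* For the uniqueness of r0, the difference of two solutions has equal         *)
(* increments along the chain of simple roots alpha_m, alpha_2m, ..., hence is *)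
(* affine in its first index; trace zero and skew-symmetry then make it 0.     *)

Set Implicit Arguments.
Unset Strict Implicit.
Unset Printing Implicit Defensive.

Import Order.TTheory GRing.Theory Num.Theory.

(** * Chains of the rotation [v |-> v + m mod n] *)

(** Let (i,j) precede (k,l), let [p] be the order and [s] the number of rotation steps from [i] to
    [j]. The entries of [a] are 0, 1 or -1 ([ggs_aE]) and [r0] is diagonal, so conjugating the
    twisted [a] by q^{r0} gives at e_ji (x) e_kl a power of q whose exponent is the sum of two
    coefficients of [r0] and one of epsilon. An off-diagonal coefficient of [r0] is 1/2 minus a
    travel time over [n]; the times that occur, from [j] to [k] and from [i] to [l], are p - s and p
    + s modulo [n]. Together they give -2p/n plus a correction that records how the two reductions
    modulo [n] fall. The theorem amounts to epsilon cancelling this correction ([ggs_eps_chain],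
    [r0_arith], [r0_eps]); the entries where [a] is -1 follow by exchanging the tensor factors
    ([ggs_eps_swap]).

    Epsilon is a signed count of intermediate pairs, evaluated by [count_splittings].
    [outer_splitting] and [inner_splitting] turn positive and negative pairs into values of one
    predicate [W] on two time windows; [W_shift] and [sum_window] slide one window onto the other,
    which yields [count_half]. The reflected rotation yields a second such identity, and by
    [splitting_time] each positive pair enters exactly one of the two. All comparisons of times rest
    on [strip_return]: since [m] is prime to [n], an orbit cannot avoid a strip of top positions,
    yet under suitable bounds every visit to the strip would require an earlier one.

    Uniqueness of [r0] is a separate linear argument ([invariant_arith], [r0_unique]). *)

Section Combinatorics.
Local Open Scope nat_scope.

Section Rotation.
Variables (n m : nat).

Definition orbit_pt (u t : nat) : nat := (u + t * m) %% n.

Local Notation pos := orbit_pt.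

(** A root is seen as an interval of length [h] above [u]. Its translates are not cut by the
    wrap-around exactly when they avoid alpha_(n-m) at each step, that is, when tau can be applied
    [q] times. *)
Definition fits (u h q : nat) : bool :=
  all (fun t => pos u t + h < n) (iota 0 q.+1).

Local Notation clear := fits.

(** For [v < n] and [m] prime to [n] this is the representative of (v - u)/m in 0, ..., n - 1, a
    discrete logarithm. The value is [n] if [v] is never reached. *)
Definition travel (u v : nat) : nat := find (fun t => pos u t == v) (iota 0 n).

Local Notation time := travel.

Definition precedes (i j k l : nat) : bool :=
  [&& i < j, j + k == i + l, 0 < time i k & clear i (j - i) (time i k)].

Local Notation pre := precedes.

Lemma clearP u h q :
  reflect (forall t, t <= q -> pos u t + h < n) (clear u h q).
Proof.
apply: (iffP allP) => H t; last by rewrite mem_iota => /H.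
by move=> le; apply: H; rewrite mem_iota.
Qed.

Lemma clearS u h q : clear u h q.+1 = clear u h q && (pos u q.+1 + h < n).
Proof. by rewrite /fits -[q.+2]addn1 iotaD all_cat /= andbT. Qed.

Lemma clear_at u h q t : clear u h q -> t <= q -> pos u t + h < n.
Proof. by move/clearP; apply. Qed.

Lemma pos_pos u s t : pos (pos u s) t = pos u (s + t).
Proof. by rewrite /orbit_pt modnDml mulnDl addnA. Qed.

Lemma pos0 u : u < n -> pos u 0 = u.
Proof. by move=> lt; rewrite /orbit_pt mul0n addn0 modn_small. Qed.

Lemma pos_shift u h t : pos u t + h < n -> pos (u + h) t = pos u t + h.
Proof. by move=> lt; rewrite -(modn_small lt) /orbit_pt modnDml addnAC. Qed.

Lemma clear_le u h h' q q' : h' <= h -> q' <= q -> clear u h q -> clear u h' q'.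
Proof.
move=> lh lq /clearP H; apply/clearP => t lt.
by have := H t (leq_trans lt lq); lia.
Qed.

Hypotheses (n_gt0 : 0 < n) (conm : coprime n m).

Lemma pos_lt u t : pos u t < n.
Proof. exact: ltn_pmod. Qed.

Lemma pos_inj_mod u s t : pos u s = pos u t -> s = t %[mod n].
Proof.
move=> /eqP; rewrite /orbit_pt eqn_modDl => /eqP e; apply/eqP.
wlog le : s t e / s <= t => [W|].
  case/orP: (leq_total s t) => le; first exact: W.
  by rewrite eq_sym; apply: W.
rewrite eq_sym eqn_mod_dvd //; move/eqP: e; rewrite eq_sym eqn_mod_dvd ?leq_mul //.
by rewrite -mulnBl Gauss_dvdl.
Qed.

Lemma pos_inj u s t : s < n -> t < n -> pos u s = pos u t -> s = t.
Proof. by move=> ls lt /pos_inj_mod; rewrite !modn_small. Qed.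

Lemma pos_modn u s : pos u (s %% n) = pos u s.
Proof. by rewrite /orbit_pt -modnDmr modnMml modnDmr. Qed.

Lemma pos_surj u v : v < n -> exists2 t, t < n & pos u t = v.
Proof.
move=> lv; pose f (t : 'I_n) : 'I_n := Ordinal (pos_lt u t).
have f_inj : injective f.
  by move=> s t /(congr1 val) /= e; apply: val_inj; apply: pos_inj e.
exists (invF f_inj (Ordinal lv)) => //.
by have /(congr1 val) := f_invF f_inj (Ordinal lv).
Qed.

Lemma time_pos u t : t < n -> time u (pos u t) = t.
Proof.
move=> lt; have has_t : has (fun s => pos u s == pos u t) (iota 0 n).
  by apply/hasP; exists t => //; rewrite mem_iota.
have := nth_find 0 has_t; rewrite -/(time u _).
have lf : time u (pos u t) < n by rewrite -[n in _ < n](size_iota 0) -has_find.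
by rewrite nth_iota // add0n => /eqP /pos_inj ->.
Qed.

Lemma pos_time u v : v < n -> pos u (time u v) = v.
Proof. by move=> /(pos_surj u) [t lt <-]; rewrite time_pos. Qed.

Lemma time_lt u v : v < n -> time u v < n.
Proof. by move=> /(pos_surj u) [t lt <-]; rewrite time_pos. Qed.

(* A full period meets the last position [n - 1]. *)
Lemma not_clear_all u h : 0 < h -> ~ (forall t, t < n -> pos u t + h < n).
Proof.
move=> h0 H; have [|t lt e] := @pos_surj u n.-1; first by rewrite prednK.
by have := H t lt; lia.
Qed.

(** An interval of positive length cannot survive a full period, so an exponent of tau is always
    below [n] and is recovered as a travel time. *)
Lemma clear_lt u h q : 0 < h -> clear u h q -> q < n.
Proof.
move=> h0 /clearP H; rewrite ltnNge; apply/negP => le.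
by apply: (@not_clear_all u h h0) => t lt; apply: H; apply: leq_trans le; exact: ltnW.
Qed.

Lemma preP i j k l : i < n ->
  reflect (exists q, [/\ 0 < q, pos i q = k, i < j, l = k + (j - i)
                       & clear i (j - i) q]) (pre i j k l).
Proof.
move=> li; apply: (iffP and4P) => [[lij /eqP e q0 c]|[q [q0 <- lij -> c]]].
  have lt := clear_lt (ltac:(lia) : 0 < j - i) c.
  exists (time i k); split=> //; last by lia.
  have : has (fun s => pos i s == k) (iota 0 n) by rewrite has_find size_iota.
  by move=> /(nth_find 0); rewrite -/(time _ _) nth_iota // => /eqP.
have lt := clear_lt (ltac:(lia) : 0 < j - i) c.
by rewrite time_pos //; split=> //; lia.
Qed.

Lemma pos_back u t a g : a * m = g %[mod n] -> a <= t -> g <= pos u t ->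
  pos u (t - a) = pos u t - g.
Proof.
move=> e le lg; have lt := pos_lt u t; have lt' := pos_lt u (t - a).
rewrite -(modn_small lt') -(modn_small (leq_ltn_trans (leq_subr g _) lt)).
apply/eqP; rewrite -(eqn_modDr g) subnK // /orbit_pt modn_mod modnDml.
by rewrite -modnDmr -e modnDmr -addnA -mulnDl subnK.
Qed.

Lemma pos_fwd u t b g : b * m + g = 0 %[mod n] -> b <= t -> pos u t + g < n ->
  pos u (t - b) = pos u t + g.
Proof.
move=> e le lg; have lt' := pos_lt u (t - b).
rewrite -(modn_small lt') -(modn_small lg).
apply/eqP; rewrite /orbit_pt modn_mod modnDml -{2}(subnK le) mulnDl addnA -addnA.
by rewrite -[X in _ == X]modnDmr e mod0n addn0.
Qed.

(* Positions [p >= n - (g1 + g2)] are traced back: one of the two translations *)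
(* leads from such a position to another one at an earlier time.               *)
Lemma strip_return u a b g1 g2 : 0 < a -> 0 < b -> 0 < g1 + g2 -> g1 + g2 <= n ->
  a * m = g1 %[mod n] -> b * m + g2 = 0 %[mod n] ->
  (forall t, t < a -> pos u t + g2 < n) ->
  (forall t, t < b -> pos u t + g2 < n -> pos u t + (g1 + g2) < n) -> False.
Proof.
move=> a0 b0 g0 gn ea eb Ha Hb.
suff H t : pos u t + (g1 + g2) < n by apply: (@not_clear_all u _ g0) => t _.
elim/ltn_ind: t => t IH; case: (ltnP (pos u t + g2) n) => lt.
- case: (ltnP t b) => tb; first exact: Hb.
  by have := IH (t - b) ltac:(lia); rewrite (pos_fwd eb) //; lia.
- case: (ltnP t a) => ta; first by have := Ha t ta; lia.
  by have := IH (t - a) ltac:(lia); rewrite (pos_back ea) //; lia.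
Qed.

End Rotation.

Lemma sum_bool_range (W : nat -> bool) (n u v : nat) :
  (forall q, u <= q < v -> W q -> q < n) ->
  \sum_(q < n) (W q && (u <= q < v)) = \sum_(u <= q < v) W q.
Proof.
move=> H; pose F q : nat := W q && (u <= q < v).
rewrite -(big_mkord xpredT F).
transitivity (\sum_(0 <= q < n + v) F q).
  rewrite (big_cat_nat (leq0n n) (leq_addr v n)) /=.
  rewrite [X in _ = _ + X]big1_seq ?addn0 // => q; rewrite mem_index_iota /F => /andP[_ le].
  case: (boolP (u <= q < v)) => [/H|]; last by rewrite andbF.
  by case: (W q) => // /(_ isT); lia.
case: (leqP u v) => uv; last first.
  by rewrite [RHS]big_geq 1?ltnW // big1 // => q _; rewrite /F; lia.
rewrite (big_cat_nat (leq0n u)) /=; last by lia.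
rewrite (big_cat_nat uv) /=; last by lia.
rewrite [X in X + _]big1_seq ?add0n; last first.
  by move=> q; rewrite mem_index_iota /F; lia.
rewrite [X in _ + X]big1_seq ?addn0; last first.
  by move=> q; rewrite mem_index_iota /F; lia.
by apply: eq_big_nat => q lq; rewrite /F lq andbT.
Qed.

(** Sliding a window of length [s] one step to the right drops [F q] and gains [F (q + s)], which
    are equal as long as q lies strictly between [s] and [p]. *)
Lemma sum_window (F : nat -> nat) (s p : nat) : s < p ->
  (forall q, s < q < p -> F q = F (q + s)) ->
  \sum_(s.+1 <= q < s + s.+1) F q = \sum_(p <= q < p + s) F q.
Proof.
move=> sp; rewrite -(subnKC sp); elim: (p - s.+1) => [|d IH] H.
  by rewrite addn0 [_.+1 + s]addnC.
rewrite IH; last by move=> q lq; apply: H; lia.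
case: s sp H {IH} => [|s] sp H; first by rewrite !addn0 !big_geq.
set r := s.+2 + d.
have -> : s.+2 + d.+1 = r.+1 by rewrite addnS.
rewrite [r + _]addnS big_ltn; last by lia.
rewrite [r.+1 + _]addSn [RHS]big_nat_recr /=; last by lia.
by rewrite -addnS -H /r 1?addnC; lia.
Qed.

(** * Factorizations of a chain: counting those on one side of [p] *)

Section Chain.
Variables (n m i j k l p s : nat).
Local Notation pos := (orbit_pt n m).
Local Notation clear := (fits n m).
Local Notation time := (travel n m).
Local Notation pre := (precedes n m).
Hypotheses (n_gt0 : 0 < n) (conm : coprime n m) (ltij : i < j).
Hypotheses (p_gt0 : 0 < p) (pos_p : pos i p = k) (def_l : l = k + (j - i)).
Hypothesis clear_p : clear i (j - i) p.
Hypotheses (lt_s : s < n) (pos_s : pos i s = j).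

Local Notation h := (j - i).

Let in_p t : t <= p -> pos i t + h < n.
Proof. by move: t; apply/clearP. Qed.

Let jlt : j < n. Proof. by rewrite -pos_s pos_lt. Qed.
Let ilt : i < n. Proof. exact: ltn_trans jlt. Qed.
Let plt : p < n. Proof. by apply: (clear_lt n_gt0 conm _ clear_p); rewrite subn_gt0. Qed.
Let llt : l < n. Proof. by rewrite def_l -pos_p; apply: in_p. Qed.

Let s_gt0 : 0 < s.
Proof. by rewrite lt0n; apply/eqP => e; move: pos_s; rewrite e pos0 //; lia. Qed.

Let pos_sD t : t <= p -> pos i (s + t) = pos i t + h.
Proof.
move=> /in_p lt; rewrite -pos_pos pos_s -(pos_shift lt); congr (orbit_pt n m _ _).
by rewrite subnKC // ltnW.
Qed.

Lemma mod_up u c a g : pos u (c + a) = pos u c + g -> a * m = g %[mod n].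
Proof.
rewrite /orbit_pt => e; apply/eqP; rewrite -(eqn_modDl (u + c * m)); apply/eqP.
by rewrite -addnA -mulnDl -[LHS]modn_mod e modnDml.
Qed.

Lemma mod_down u c b g : pos u (c + b) + g = pos u c -> b * m + g = 0 %[mod n].
Proof.
rewrite /orbit_pt => e; apply/eqP; rewrite -(eqn_modDl (u + c * m)) addn0; apply/eqP.
by rewrite addnA -[u + _ + _]addnA -mulnDl -modnDml e modn_mod.
Qed.

Let W q := (pos i q < l) && clear i (l - pos i q) q.

Let W_lt q : W q -> q < n.
Proof. by case/andP=> lt; apply: clear_lt => //; rewrite subn_gt0. Qed.

(** Otherwise the orbit would go from [pos i q] up by [l - pos i q] in p + s - q steps and down to
    [k] in p - q steps. Both numbers are below [p], a range in which positions leave room [h], the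
    sum of the two translations; [strip_return] excludes this. *)
Lemma W_low q : s < q < p -> W q -> h < l - pos i q.
Proof.
move=> /andP[sq qp] Wq; rewrite ltnNge; apply/negP => le.
have /andP[lt /clearP c] := Wq.
have yq : pos i q != k.
  by rewrite -pos_p; apply/eqP => /(pos_inj conm (W_lt Wq) plt); lia.
have e1 : pos i (q + (p + s - q)) = pos i q + (l - pos i q).
  have -> : q + (p + s - q) = s + p by lia.
  by rewrite pos_sD // pos_p subnKC ?def_l // ltnW -?def_l.
have e2 : pos i (q + (p - q)) + (h - (l - pos i q)) = pos i q.
  by rewrite subnKC ?pos_p; lia.
apply: (strip_return n_gt0 conm _ _ _ _ (mod_up e1) (mod_down e2) _ (u := i)); try lia.
- by move=> t lt'; have := in_p (_ : t <= p); lia.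
- by move=> t lt'; have := in_p (_ : t <= p); lia.
Qed.

(** Here the translations given to [strip_return] are up by [h] in [s] steps (from [i] to [j]) and
    down from [k] to [pos i q] in q - p steps; their sum is the room granted by [W q]. *)
Lemma W_high q : p < q -> s < q -> W q -> l - pos i q < h.
Proof.
move=> pq sq Wq; rewrite ltnNge; apply/negP => le.
have /andP[lt /clearP c] := Wq.
have yq : pos i q != k.
  by rewrite -pos_p; apply/eqP => /(pos_inj conm (W_lt Wq) plt); lia.
have e1 : pos i (0 + s) = pos i 0 + h by rewrite add0n pos_s pos0; lia.
have e2 : pos i (p + (q - p)) + (l - pos i q - h) = pos i p.
  by rewrite subnKC ?pos_p; lia.
have := c 0; rewrite pos0 // => c0.
apply: (strip_return n_gt0 conm _ _ _ _ (mod_up e1) (mod_down e2) _ (u := i)); try lia.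
- by move=> t lt'; have := c t; lia.
- by move=> t lt'; have := c t; lia.
Qed.

(** Positions at time s + t are those at time t raised by [h]. Hence the interval ending at [l]
    loses its lowest part of length [h], and [W_low] guarantees that something remains. *)
Lemma W_shift q : s < q < p -> W q = W (q + s).
Proof.
move=> lq; have qp : q <= p by lia.
have e := pos_sD qp; have lt := in_p qp; rewrite addnC.
apply/idP/idP => Wq.
- have low := W_low lq Wq; have /andP[lt' /clearP c] := Wq.
  apply/andP; split; first by lia.
  apply/clearP => t le; case: (leqP t q) => tq; first by have := c t tq; lia.
  have := pos_sD (_ : t - s <= p); rewrite subnKC; try lia.
  by have := c (t - s); have := in_p (_ : t - s <= p); lia.
- have /andP[lt' /clearP c] := Wq; apply/andP; split; first by lia.
  apply/clearP => t le; have := c (s + t); rewrite pos_sD; last by lia.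
  by lia.
Qed.

Lemma window_bound q f : 0 < f -> q <= s -> clear i f s -> clear i (h + f) q ->
  pos i q + f = k -> q < p.
Proof.
move=> f0 qs /clearP cs /clearP cq eq; rewrite ltnNge; apply/negP => le.
have pq : p != q by apply/eqP => e; move: eq; rewrite -e pos_p; lia.
have e1 : pos i (0 + s) = pos i 0 + h by rewrite add0n pos_s pos0; lia.
have e2 : pos i (p + (q - p)) + f = pos i p by rewrite subnKC ?pos_p; lia.
have := cq 0; rewrite pos0 // => c0.
apply: (strip_return n_gt0 conm _ _ _ _ (mod_up e1) (mod_down e2) _ (u := i)); try lia.
- by move=> t lt'; have := cs t; lia.
- by move=> t lt'; have := cq t; lia.
Qed.

Lemma pos_injl u v t : u < n -> v < n -> pos u t = pos v t -> u = v.
Proof.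
move=> lu lv /eqP; rewrite /orbit_pt eqn_modDr => /eqP.
by rewrite !modn_small.
Qed.

(** If (x,j) precedes (k,y) in p' steps, then going from [i] through [j] to y takes s + p' steps, so
    q is s + p' modulo [n]. With 0 < p' < p this places q in the window; conversely p' is recovered
    as q - s. *)
Lemma outer_splitting q : q < n ->
  [&& pre (j + k - pos i q) j k (pos i q), pre i (j + k - pos i q) (pos i q) l
    & p < q] = W q && ((maxn p s).+1 <= q < p + s).
Proof.
move=> qn; set y := pos i q; set x := j + k - y.
apply/idP/idP.
- case/and3P=> A B pq.
  have xn : x < n by case/and4P: A; lia.
  have /(preP n_gt0 conm _ _ _ xn) [p' [p'0 ex xj ey /clearP cA]] := A.
  have /(preP n_gt0 conm _ _ _ ilt) [q' [q'0 eq' ix el cB]] := B.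
  have p'n : p' < n by apply: (@clear_lt n m n_gt0 conm x (j - x)); [lia | apply/clearP].
  have q'n : q' < n by apply: (clear_lt n_gt0 conm _ cB); lia.
  have {eq'} q'E : q' = q by apply: (pos_inj conm q'n qn eq').
  rewrite q'E in cB; clear q' q'0 q'n q'E; have /clearP cB' := cB.
  have WQ : W q.
    rewrite /W -/y; have -> : l - y = x - i by lia.
    by rewrite cB andbT; lia.
  rewrite WQ /=.
  (* If p' were at least [p], the orbit would go up by j - x in q - p steps and down by x - i in p'
     - p steps, and the two translations add up to [h]. *)
  have p'p : p' < p.
    rewrite ltnNge; apply/negP => le.
    have ne : p' != p.
      by apply/eqP => e; have := @pos_injl x i p; rewrite -{1}e ex pos_p; lia.
    have e1 : pos i (p + (q - p)) = pos i p + (h - (x - i)).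
      by rewrite subnKC ?pos_p -/y; lia.
    have e2 : (p' - p) * m + (x - i) = 0 %[mod n].
      apply/eqP; rewrite -(eqn_modDl (i + p * m)) addn0.
      have -> : i + p * m + ((p' - p) * m + (x - i)) = x + p' * m by nia.
      by apply/eqP; rewrite -/(orbit_pt n m x p') -/(orbit_pt n m i p) ex pos_p.
    have c0 := cB' 0 isT; rewrite pos0 // in c0.
    apply: (strip_return n_gt0 conm _ _ _ _ (mod_up e1) e2 _ (u := i)); try lia.
    + by move=> t lt'; have := cB' t; lia.
    + move=> t lt' lt''; have := cA t; have := pos_shift lt''.
      by rewrite (subnKC (ltnW ix)); lia.
  have e : pos i q = pos i (p' + s).
    rewrite addnC -pos_pos pos_s.
    have := cA p' (leqnn _) => /pos_shift; rewrite subnKC; last by lia.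
    by rewrite -/y; lia.
  have : q = p' + s %[mod n] by exact: pos_inj_mod e.
  rewrite (modn_small qn); case: (ltnP (p' + s) n) => lt; first by rewrite modn_small //; lia.
  by rewrite -[p' + s](subnK lt) modnDr modn_small; lia.
- case/andP=> Wq /andP[]; rewrite gtn_max => /andP[pq sq] qps.
  have hi := W_high pq sq Wq; have /andP[ltyl cB] := Wq; rewrite -/y in hi ltyl cB.
  have ex : x = i + (l - y) by lia.
  have /clearP cB' := cB.
  have p'p : q - s <= p by lia.
  have e1 := pos_sD p'p; rewrite subnKC ?(ltnW sq) // -/y in e1.
  have e2 := in_p p'p.
  have c0 := cB' 0 isT; rewrite pos0 // in c0.
  rewrite pq andbT; apply/andP; split.
  + apply/preP; [done|done|lia|exists (q - s); split; try lia].
    * by rewrite ex pos_shift; lia.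
    * apply/clearP => t lt; have lt' : pos i t + h < n by apply: in_p; lia.
      by rewrite ex pos_shift; lia.
  + apply/preP; [done|done|lia|exists q; split; try lia].
    by have -> : x - i = l - y by lia.
Qed.

(** The interval of length k - y above [i] is at (y,k) at time q and at (j,x) at time [s]. Raising
    the uncut longer interval of the second relation by [h] keeps it uncut up to time q + s, which
    is [W (q + s)]; [window_bound] supplies q < p. *)
Lemma inner_splitting q : q < n ->
  (pre (pos i q) k j (j + k - pos i q) && pre i (j + k - pos i q) (pos i q) l) +
    ((q == s) && (pre i k j l && (j < k)))
  = (W (q + s) && (1 <= q < (minn s p.-1).+1)) :> nat.
Proof.
move=> qn; set y := pos i q; set x := j + k - y.
have main : [&& 0 < q, q <= s, y < k, clear i (h + (k - y)) q & clear i (k - y) s]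
    = W (q + s) && (1 <= q < (minn s p.-1).+1).
  apply/idP/idP.
  - case/and5P=> q0 qs yk cq cs.
    have qp : q < p by apply: (window_bound _ qs cs cq); rewrite -/y; lia.
    have ey := pos_sD (ltnW qp); rewrite -/y in ey.
    apply/andP; split; last by lia.
    rewrite addnC /W ey; apply/andP; split; first by lia.
    have -> : l - (y + h) = k - y by lia.
    apply/clearP => t lt; case: (leqP t s) => ts; first by move: t ts {lt}; apply/clearP.
    have := pos_sD (_ : t - s <= p); rewrite subnKC; try lia.
    by have /clearP/(_ (t - s)) := cq; lia.
  - case/andP=> /andP[]; rewrite addnC => ly /clearP c lq.
    have qp : q <= p by lia.
    have ey := pos_sD qp; rewrite -/y in ey; rewrite ey in ly c.
    have ek : l - (y + h) = k - y by lia.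
    rewrite ek in c; apply/and5P; split; try lia.
    + apply/clearP => t lt; have := c (s + t); rewrite pos_sD; last by lia.
      by lia.
    + by apply/clearP => t lt; apply: c; lia.
rewrite -main; clear main; have [eqs|qs] := eqVneq q s.
  (* At q = s the pair degenerates to (j,k), which does not precede itself; its place is taken by
     the boundary term, which arises from the products with r_s. *)
  have ey : y = j by rewrite /y eqs.
  have ex : x = k by rewrite /x ey addnC addnK.
  have tj : time j j = 0 by rewrite -{2}(pos0 m jlt) time_pos.
  have ti : time i j = s by rewrite -pos_s time_pos.
  rewrite ey ex eqs leqnn /pre tj ltnn !andbF add0n ti s_gt0 /=.
  case: (ltnP j k) => jk; last by rewrite !andbF.
  have -> : h + (k - j) = k - i by lia.
  have -> : i < k by lia.
  have -> : k + j == i + l by apply/eqP; lia.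
  rewrite ?andbT /=; case: (boolP (clear i (k - i) s)) => // c.
  by rewrite (clear_le _ (leqnn s) c) //; lia.
rewrite addn0; congr (nat_of_bool _); apply/idP/idP.
- case/andP=> A B.
  have yn : y < n by apply: pos_lt.
  have /(preP n_gt0 conm _ _ _ yn) [d [d0 ed yk ex /clearP cA]] := A.
  have /(preP n_gt0 conm _ _ _ ilt) [q' [q'0 eq' ix el cB]] := B.
  have q'n : q' < n by apply: (clear_lt n_gt0 conm _ cB); lia.
  have {eq'} q'E : q' = q by apply: (pos_inj conm q'n qn eq').
  rewrite q'E in cB q'0; clear q' q'n q'E; have /clearP cB' := cB.
  have c t : t <= q + d -> pos i t + (k - y) < n.
    move=> le; case: (leqP t q) => tq; first by have := cB' t tq; lia.
    have := cA (t - q); rewrite pos_pos subnKC; lia.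
  have lt : q + d < n.
    by apply: (@clear_lt n m n_gt0 conm i (k - y)); [lia | apply/clearP].
  have es : q + d = s.
    by apply: (pos_inj conm lt lt_s (u := i)); rewrite pos_s -ed pos_pos.
  have -> : h + (k - y) = x - i by lia.
  rewrite q'0 yk cB /=; apply/andP; split; first by lia.
  by rewrite -es; apply/clearP.
- case/and5P=> q0 qles yk cq /clearP cs.
  have /clearP cq' := cq; have := cq' 0 isT; rewrite pos0 // => c0.
  apply/andP; split; apply/preP => //; try by apply: pos_lt.
  + exists (s - q); split; try lia.
      by rewrite pos_pos subnKC.
    by apply/clearP => t lt; rewrite pos_pos; apply: cs; lia.
  + exists q; split; try lia.
    by have -> : x - i = h + (k - y) by lia.
Qed.

Lemma sum_pairs (B : nat -> nat -> bool) :
  (forall x y, B x y -> x + y = j + k /\ x < n) ->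
  \sum_(x < n) \sum_(y < n) B x y =
  \sum_(q < n) B (j + k - pos i q) (pos i q) :> nat.
Proof.
move=> H; rewrite exchange_big /=.
pose f (q : 'I_n) := Ordinal (pos_lt m n_gt0 i q).
have f_inj : injective f.
  by move=> u v /(congr1 val) /= e; apply: val_inj; apply: (pos_inj conm _ _ e).
rewrite (reindex_inj f_inj) /=; apply: eq_bigr => q _.
set y := pos i q; case: (ltnP (j + k - y) n) => lt.
  rewrite (bigD1 (Ordinal lt)) //= big1 ?addn0 // => x /eqP ne.
  case: (boolP (B x y)) => // /H[e _]; case: ne; apply: val_inj => /=; lia.
rewrite big1 => [|x _].
  by case: (boolP (B _ y)) => // /H[_]; lia.
by case: (boolP (B x y)) => // /H[e lx]; lia.
Qed.

Lemma pre_lt u v w z : u < n -> pre u v w z -> v < n.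
Proof.
move=> un /(preP n_gt0 conm _ _ _ un) [q [_ _ uv _ /clearP/(_ 0 isT)]].
by rewrite pos0 //; lia.
Qed.

(** For [p <= s] both sides sum [W] over the same window. For [s < p] the windows match after
    sliding, up to the value [W p]; it is 1 because it describes the given chain itself. *)
Lemma count_half :
  \sum_(x < n) \sum_(y < n) (pre y k j x && pre i x y l) + (pre i k j l && (j < k))
  = \sum_(x < n) \sum_(y < n) [&& pre x j k y, pre i x y l & p < time i y] + (s < p)
  :> nat.
Proof.
rewrite (sum_pairs (B := fun x y => pre y k j x && pre i x y l)); last first.
  move=> x y /andP[/and4P[_ /eqP e _ _] B]; split; first by lia.
  exact: pre_lt ilt B.
rewrite (sum_pairs (B := fun x y => [&& pre x j k y, pre i x y l & p < time i y])); last first.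
  by move=> x y /and3P[/and4P[xj /eqP e _ _] _ _]; lia.
have -> : (pre i k j l && (j < k) : nat) =
    \sum_(q < n) ((q == s :> nat) && (pre i k j l && (j < k))).
  rewrite (bigD1 (Ordinal lt_s)) //= eqxx big1 ?addn0 // => q /eqP ne.
  by case: eqP => // e; case: ne; apply: val_inj.
rewrite -big_split /= (eq_bigr _ (fun q _ => inner_splitting (ltn_ord q))).
rewrite [X in _ = X + _](eq_bigr (fun q : 'I_n =>
    W q && ((maxn p s).+1 <= q < p + s) : nat)); last first.
  by move=> q _; rewrite time_pos // outer_splitting.
rewrite (sum_bool_range (W := fun q => W (q + s))); last by move=> q _ /W_lt; lia.
rewrite (sum_bool_range (W := W)); last by move=> q _ /W_lt.
have shift N : \sum_(1 <= q < N) W (q + s) = \sum_(s.+1 <= q < N + s) W q :> nat.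
  by rewrite -[s.+1]add1n big_addn addnK.
rewrite shift; case: (ltnP s p) => sp; last first.
  rewrite addn0; have -> : minn s p.-1 = p.-1 by lia.
  by have -> : p.-1.+1 = p by lia.
have -> : minn s p.-1 = s by lia.
rewrite addSnnS (sum_window sp); last by move=> q /W_shift ->.
rewrite big_ltn; last by lia.
rewrite addnC; congr (_ + _).
have -> // : W p; rewrite /W pos_p.
have -> : l - k = h by lia.
by rewrite clear_p andbT; lia.
Qed.

End Chain.

(** * Reflection of positions *)

Section Mirror.
Variables n m m' : nat.
Hypotheses (n_gt0 : 0 < n) (mm' : m + m' = n).

(** Reflection conjugates the rotation by [m] to its inverse, the rotation by n - m. It reverses
    intervals, so both ends of a root are exchanged in [pre_mirror]. *)
Lemma pos_mirror u t : u < n -> orbit_pt n m' (n.-1 - u) t = n.-1 - orbit_pt n m u t.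
Proof.
move=> lt; have lt1 := pos_lt m n_gt0 u t; have lt2 := pos_lt m' n_gt0 (n.-1 - u) t.
have : orbit_pt n m' (n.-1 - u) t + orbit_pt n m u t = n.-1 %[mod n].
  rewrite /orbit_pt modnDml modnDmr.
  have -> : n.-1 - u + t * m' + (u + t * m) = t * n + n.-1 by rewrite -mm'; nia.
  by rewrite modnMDl.
rewrite [RHS]modn_small ?prednK //.
case: (ltnP (orbit_pt n m' (n.-1 - u) t + orbit_pt n m u t) n) => le.
  by rewrite modn_small //; lia.
by rewrite -[X in X %% _](subnK le) modnDr modn_small; lia.
Qed.

Hypothesis conm : coprime n m.

Lemma coprime_mirror : coprime n m'.
Proof.
move: conm; rewrite -mm' coprime_sym /coprime gcdnDl => co.
by rewrite gcdnC gcdnDr gcdnC.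
Qed.

Lemma time_mirror u v : u < n -> v < n ->
  travel n m' (n.-1 - u) (n.-1 - v) = travel n m u v.
Proof.
move=> lu lv; rewrite -{1}(pos_time n_gt0 conm u lv) -pos_mirror //.
by rewrite time_pos ?time_lt // coprime_mirror.
Qed.

End Mirror.

Lemma pre_mirror_sub n m m' u v w z : 0 < n -> coprime n m -> m + m' = n ->
  u < n -> v < n -> w < n -> z < n ->
  precedes n m u v w z -> precedes n m' (n.-1 - v) (n.-1 - u) (n.-1 - z) (n.-1 - w).
Proof.
move=> n_gt0 conm mm' lu lv lw lz.
have conm' := coprime_mirror mm' conm.
move=> /(preP n_gt0 conm _ _ _ lu) [q [q0 eq uv ez /clearP c]].
apply/preP => //; first by lia.
have sh t : t <= q -> orbit_pt n m v t = orbit_pt n m u t + (v - u).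
  by move=> /c /pos_shift <-; rewrite subnKC // ltnW.
exists q; split; try lia.
- by rewrite (pos_mirror n_gt0 mm') // sh // eq; lia.
- apply/clearP => t /[dup] le /c lt; rewrite (pos_mirror n_gt0 mm') // sh //; lia.
Qed.

Lemma pre_mirror n m m' u v w z : 0 < n -> coprime n m -> m + m' = n ->
  u < n -> v < n -> w < n -> z < n ->
  precedes n m' (n.-1 - v) (n.-1 - u) (n.-1 - z) (n.-1 - w) = precedes n m u v w z.
Proof.
move=> n_gt0 conm mm' lu lv lw lz; apply/idP/idP; last exact: pre_mirror_sub.
have inv x : x < n -> n.-1 - (n.-1 - x) = x by lia.
move=> /(pre_mirror_sub n_gt0 (coprime_mirror mm' conm)); rewrite !inv //.
by apply; rewrite ?[m' + m]addnC //; lia.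
Qed.

(** * The complete count *)

Section Chain.
Variables (n m i j k l p s : nat).
Local Notation pos := (orbit_pt n m).
Local Notation clear := (fits n m).
Local Notation time := (travel n m).
Local Notation pre := (precedes n m).
Hypotheses (n_gt0 : 0 < n) (conm : coprime n m) (ltmn : m < n) (ltij : i < j).
Hypotheses (p_gt0 : 0 < p) (pos_p : pos i p = k) (def_l : l = k + (j - i)).
Hypothesis clear_p : clear i (j - i) p.
Hypotheses (lt_s : s < n) (pos_s : pos i s = j).

Let jlt : j < n. Proof. by rewrite -pos_s pos_lt. Qed.
Let ilt : i < n. Proof. exact: ltn_trans jlt. Qed.
Let plt : p < n. Proof. by apply: (clear_lt n_gt0 conm _ clear_p); rewrite subn_gt0. Qed.
Let klt : k < n. Proof. by rewrite -pos_p pos_lt. Qed.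
Let llt : l < n.
Proof. by rewrite def_l -pos_p; apply: clear_at clear_p _. Qed.

Lemma pre_time u v w z : u < n -> pre u v w z -> time v z = time u w.
Proof.
move=> lu /(preP n_gt0 conm _ _ _ lu) [q [q0 <- uv -> c]].
have qn : q < n by apply: (clear_lt n_gt0 conm _ c); lia.
have := pos_shift (clear_at c (leqnn q)); rewrite subnKC ?(ltnW uv) // => <-.
by rewrite !time_pos.
Qed.

(** Write p' and q for the orders of the two relations. If both exceeded [p], [outer_splitting]
    would give s < q < p + s, against q being s + p' modulo [n]. If neither did, times p - p' and p
    - q would realize translations up by x - i and down by y - k, of total length [h], within the
    uncut range of the chain. *)
Lemma splitting_time x y : x < n -> pre x j k y -> pre i x y l ->
  (p < time j y) = ~~ (p < time i y).
Proof.
move=> xn A B; rewrite (pre_time xn A).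
have /(preP n_gt0 conm _ _ _ xn) [p' [p'0 ep xj ey cA]] := A.
have /(preP n_gt0 conm _ _ _ ilt) [q [q0 eq ix el cB]] := B.
have qn : q < n by apply: (clear_lt n_gt0 conm _ cB); lia.
have p'n : p' < n by apply: (clear_lt n_gt0 conm _ cA); lia.
rewrite -{1}ep -eq !time_pos //; apply/idP/idP => [pp'|].
- apply/negP => pq.
  have := outer_splitting n_gt0 conm ltij p_gt0 pos_p def_l clear_p lt_s pos_s qn.
  have ex : j + k - pos i q = x by rewrite eq; lia.
  rewrite ex eq A B pq /= => /esym /andP[_]; rewrite gtn_max => /andP[/andP[_ sq] qps].
  have : pos i (s + p') = pos i q.
    rewrite -pos_pos pos_s eq ey -ep -(pos_shift (clear_at cA (leqnn _))).
    by rewrite subnKC // ltnW.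
  move/(pos_inj_mod conm); rewrite (modn_small qn).
  case: (ltnP (s + p') n) => lt; first by rewrite modn_small //; lia.
  by rewrite -[s + p'](subnK lt) modnDr modn_small; lia.
- rewrite -leqNgt => qp; rewrite ltnNge; apply/negP => p'p.
  have ne1 : q != p by apply/eqP => e; move: eq; rewrite e pos_p; lia.
  have ne2 : p' != p.
    by apply/eqP => e; have := @pos_injl n m x i p; rewrite -{1}e ep pos_p; lia.
  have e1 : (p - p') * m = x - i %[mod n].
    apply/eqP; rewrite -(eqn_modDl (i + p' * m)).
    have -> : i + p' * m + (p - p') * m = i + p * m by nia.
    have -> : i + p' * m + (x - i) = x + p' * m by lia.
    by apply/eqP; rewrite -/(orbit_pt n m x p') -/(orbit_pt n m i p) ep.
  have e2 : pos i (q + (p - q)) + (y - k) = pos i q by rewrite subnKC ?pos_p; lia.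
  apply: (strip_return n_gt0 conm _ _ _ _ e1 (mod_down e2) _ (u := i)); try lia.
  + by move=> t lt'; have := clear_at clear_p (_ : t <= p); lia.
  + by move=> t lt'; have := clear_at clear_p (_ : t <= p); lia.
Qed.

(** Add [count_half] for the chain and for its mirror image. In the latter the roles of [i] and [j]
    are exchanged, so [s] becomes n - s. *)
Lemma count_splittings :
  \sum_(x < n) \sum_(y < n) (pre x j k y && pre i x y l) + (s < p) + (n - s < p) =
  \sum_(x < n) \sum_(y < n) (pre y k j x && pre i x y l) +
  \sum_(x < n) \sum_(y < n) (pre l y x i && pre x j k y) +
  (pre i k j l && (j < k)) + (pre l j k i && (l < i)) :> nat.
Proof.
have E := count_half n_gt0 conm ltij p_gt0 pos_p def_l clear_p lt_s pos_s.
pose m' := n - m; have mm' : m + m' = n by rewrite subnKC // ltnW.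
have s0 : 0 < s by rewrite lt0n; apply/eqP => e; move: pos_s; rewrite e pos0 //; lia.
have E' :
  \sum_(x < n) \sum_(y < n) (pre l y x i && pre x j k y) + (pre l j k i && (l < i))
  = \sum_(x < n) \sum_(y < n) [&& pre x j k y, pre i x y l & p < time j y] + (n - s < p).
  have eh : n.-1 - i - (n.-1 - j) = j - i by lia.
  have c t : t <= p -> pos j t = pos i t + (j - i).
    by move=> /(clear_at clear_p) /pos_shift; rewrite subnKC // ltnW.
  have H1 : orbit_pt n m' (n.-1 - j) p = n.-1 - l.
    by rewrite (pos_mirror n_gt0 mm') // c // pos_p def_l.
  have H2 : fits n m' (n.-1 - j) (n.-1 - i - (n.-1 - j)) p.
    rewrite eh; apply/clearP => t le; rewrite (pos_mirror n_gt0 mm') // c //.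
    by have := clear_at clear_p le; lia.
  have H3 : orbit_pt n m' (n.-1 - j) (n - s) = n.-1 - i.
    rewrite (pos_mirror n_gt0 mm') //.
    have := pos_pos n m i s (n - s); rewrite pos_s subnKC ?(ltnW lt_s) // => ->.
    by rewrite -(pos_modn n m i n) modnn pos0.
  have := @count_half n m' (n.-1 - j) (n.-1 - i) (n.-1 - l) (n.-1 - k) p (n - s) n_gt0
    (coprime_mirror mm' conm) (ltac:(lia)) p_gt0 H1 (ltac:(lia)) H2 (ltac:(lia)) H3.
  rewrite !(pre_mirror n_gt0 conm mm') //.
  have -> : (n.-1 - i < n.-1 - l) = (l < i) by lia.
  have rev (F G : nat -> nat -> nat) :
      (forall x y, x < n -> y < n -> F (n.-1 - x) (n.-1 - y) = G x y) ->
      \sum_(x < n) \sum_(y < n) F x y = \sum_(x < n) \sum_(y < n) G x y.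
    move=> FG; rewrite (reindex_inj rev_ord_inj); apply: eq_bigr => x _.
    rewrite (reindex_inj rev_ord_inj); apply: eq_bigr => y _ /=.
    by rewrite -FG //; congr (F _ _); lia.
  have -> := rev (fun x y => precedes n m' y (n.-1 - l) (n.-1 - i) x &&
      precedes n m' (n.-1 - j) x y (n.-1 - k) : nat)
    (fun x y => pre l y x i && pre x j k y : nat); last first.
    by move=> x y lx ly; rewrite !(pre_mirror n_gt0 conm mm').
  have -> // := rev (fun x y => [&& precedes n m' x (n.-1 - i) (n.-1 - l) y,
      precedes n m' (n.-1 - j) x y (n.-1 - k) & p < travel n m' (n.-1 - j) y] : nat)
    (fun x y => [&& pre x j k y, pre i x y l & p < time j y] : nat).
  move=> x y lx ly; rewrite !(pre_mirror n_gt0 conm mm') //.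
  by rewrite (time_mirror n_gt0 mm' conm) //; case: (pre x j k y) (pre i x y l) => -[].
have -> : \sum_(x < n) \sum_(y < n) (pre x j k y && pre i x y l) =
    \sum_(x < n) \sum_(y < n) [&& pre x j k y, pre i x y l & p < time i y] +
    \sum_(x < n) \sum_(y < n) [&& pre x j k y, pre i x y l & p < time j y] :> nat.
  rewrite -big_split; apply: eq_bigr => x _; rewrite -big_split; apply: eq_bigr => y _ /=.
  case: (boolP (pre x j k y)) => // A; case: (boolP (pre i x y l)) => // B.
  by rewrite (splitting_time _ A B) //=; case: (_ < _).
lia.
Qed.
End Chain.

End Combinatorics.

Local Open Scope ring_scope.

(** * The order relation of the generalized Cremmer-Gervais triple *)

Section Tau.
Variables (C : numFieldType) (n : nat).

Definition unit_row (t : nat) : 'rV[C]_n := \row_x (x == t :> nat)%:R.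

Lemma rvecE (a : rootidx n) : rvec C a = unit_row a.1 - unit_row a.2.
Proof. by apply/rowP => x; rewrite !mxE !eqxx. Qed.

Lemma rvec_inj (a b : rootidx n) : rpos a -> rpos b -> rvec C a = rvec C b -> a = b.
Proof.
case: a b => [a1 a2] [b1 b2] /=; rewrite /rpos /= => la lb e.
have E (x : 'I_n) := congr1 (fun v : 'rV[C]_n => v 0 x) e.
have one (u v : bool) : (1 : C) = u%:R - v%:R -> u.
  case: u v => -[] // /eqP; last by rewrite subrr oner_eq0.
  by rewrite mulr0n sub0r -subr_eq0 opprK -[1 + 1]/(2%:R) pnatr_eq0.
have := E a1; have := E a2; rewrite !rvecE !mxE /=.
rewrite !eqxx (gtn_eqF la) (ltn_eqF la) subr0 sub0r => e2 /one /eqP e1.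
have e1' : a1 = b1 by apply: val_inj.
subst b1; congr (_, _); apply: val_inj; apply/eqP.
by move: e2 => /(congr1 -%R); rewrite opprK opprB => /one.
Qed.

Lemma sum_simple_roots (V : zmodType) (F : rootidx n -> V) (f : nat -> V) u v :
  (v < n)%N ->
  (forall g : rootidx n, g \in simple_roots n -> (u <= g.1 < v)%N -> F g = f g.1) ->
  \sum_(g in simple_roots n | (u <= g.1 < v)%N) F g = \sum_(u <= t < v) f t.
Proof.
move=> vn Ff; rewrite (eq_bigr (fun g : rootidx n => f g.1)); last first.
  by move=> g /andP[gS lg]; apply: Ff.
rewrite (eq_bigl (fun g : rootidx n =>
    (u <= g.1 < v)%N && (g.2 == g.1.+1 :> nat))); last by move=> g; rewrite inE andbC.
rewrite -(pair_big_dep (fun x : 'I_n => (u <= x < v)%N)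
  (fun x y : 'I_n => y == x.+1 :> nat) (fun x _ => f x)) /=.
rewrite (eq_bigr (fun x : 'I_n => f x)); last first.
  move=> x /andP[_ xv]; rewrite (bigD1 (Ordinal (leq_ltn_trans xv vn))) //= big1 ?addr0 //.
  by move=> y /andP[/eqP e /eqP ne]; case: ne; apply: val_inj.
by rewrite (big_nat_widenl _ 0%N) // (big_nat_widen _ _ n) 1?ltnW // big_mkord.
Qed.

Lemma sum_unit_rows (f : nat -> nat) u v : (u <= v)%N ->
  \sum_(u <= t < v) (unit_row (f t) - unit_row (f t.+1)) =
  unit_row (f u) - unit_row (f v).
Proof.
move=> uv; rewrite -[RHS]opprB -(telescope_sumr (fun t => unit_row (f t))) //.
by rewrite -sumrN; apply: eq_bigr => t _; rewrite opprB.
Qed.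

(** The functional equal to 1 on the first [c] basis vectors and 0 on the others kills every simple
    root except alpha_c, hence detects whether alpha_c occurs in [a]. *)
Lemma mem_tilde (c : nat) (a : rootidx n) :
  (a \in tilde C [set g in simple_roots n | label g != c]) =
  (a.1 < a.2)%N && ~~ (a.1 < c <= a.2)%N.
Proof.
rewrite inE /rpos; case: (ltnP a.1 a.2) => //= lt; apply/idP/idP.
- move=> aY; apply/negP => /andP[a1c a2c].
  pose w : 'cV[C]_n := \col_x (x < c)%:R.
  have wE (b : rootidx n) : (rvec C b *m w) 0 0 = (b.1 < c)%:R - (b.2 < c)%:R.
    rewrite !mxE (eq_bigr (fun x : 'I_n =>
        (x == b.1)%:R * (x < c)%:R - (x == b.2)%:R * (x < c)%:R)); last first.
      by move=> x _; rewrite rvecE !mxE mulrBl.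
    rewrite sumrB; congr (_ - _).
    + by rewrite (bigD1 b.1) //= eqxx mul1r big1 ?addr0 // => x /negbTE ->; rewrite mul0r.
    + by rewrite (bigD1 b.2) //= eqxx mul1r big1 ?addr0 // => x /negbTE ->; rewrite mul0r.
  have sub : (<<[seq rvec C g | g in [set g in simple_roots n | label g != c]]>> <=
      lker (linfun (mulmxr w)))%VS.
    apply/span_subvP => _ /mapP[g + ->]; rewrite mem_enum !inE /label => /andP[/eqP e ne].
    rewrite memv_ker lfunE /=; apply/eqP/matrixP => x y; rewrite !ord1 wE e mxE.
    have -> : (g.1.+1 < c)%N = (g.1 < c)%N by rewrite [LHS]ltn_neqAle ne.
    by rewrite subrr.
  have := subvP sub _ aY; rewrite memv_ker lfunE /= => /eqP/matrixP/(_ 0 0).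
  by rewrite wE a1c mxE ltnNge a2c subr0 => /eqP; rewrite oner_eq0.
- move=> nc.
  have -> : rvec C a = \sum_(g in simple_roots n | (a.1 <= g.1 < a.2)%N) rvec C g.
    rewrite (sum_simple_roots (f := fun t => unit_row t - unit_row t.+1)) //.
      by rewrite (sum_unit_rows (fun t => t)) 1?ltnW // -rvecE.
    by move=> g; rewrite inE => /eqP e _; rewrite rvecE e.
  apply: memv_suml => g /andP[gS lg]; apply: memv_span; apply/mapP; exists g => //.
  rewrite mem_enum inE gS /=; apply/eqP => e.
  by move: nc; rewrite -e /label ltnS; case/andP: lg => -> ->.
Qed.

Variable m : nat.
Hypotheses (m_gt0 : (0 < m)%N) (ltmn : (m < n)%N) (conm : coprime n m).
Local Notation T := (CG_triple C m_gt0 ltmn conm).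
Local Notation pos := (orbit_pt n m).
Local Notation clear := (fits n m).

Let n_gt0 : (0 < n)%N. Proof. exact: ltn_trans ltmn. Qed.

Definition turn (t : nat) (x : 'I_n) : 'I_n := Ordinal (pos_lt m n_gt0 x t).

Lemma CGtau_turn (a : rootidx n) : a \in CG1 n m -> CGtau m a = (turn 1 a.1, turn 1 a.2).
Proof.
move=> g1; have nz0 := CG_mod m_gt0 ltmn conm g1.
have /eqP ea : a.2 == a.1.+1 :> nat by move: g1; rewrite !inE => /andP[].
have [] := CGtauP m_gt0 ltmn conm g1; rewrite inE /label => /eqP e2 e1.
rewrite [LHS]surjective_pairing; congr (_, _); apply: val_inj; rewrite /= /orbit_pt mul1n.
  have : (a.1 + m + 1 = (CGtau m a).1 + 1 %[mod n])%N.
    by rewrite addn1 -addSn -e1 addn1 [in RHS]modn_small // e1 ltn_mod.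
  by move/eqP; rewrite eqn_modDr [X in _ == X]modn_small // => /eqP.
by rewrite e2 e1 ea.
Qed.

(** A root not involving alpha_(n-m) is an interval that one rotation does not cut; the sum of its
    rotated simple roots telescopes to the two rotated ends. *)
Lemma tau_extE (a : rootidx n) : tau_ext T a =
  if (a.1 < a.2)%N && (pos a.1 1 + (a.2 - a.1) < n)%N
  then Some (turn 1 a.1, turn 1 a.2) else None.
Proof.
rewrite /tau_ext mem_tilde; have a1n := ltn_ord a.1; have a2n := ltn_ord a.2.
case: (ltnP a.1 a.2) => //= lt; rewrite /orbit_pt mul1n.
have posE (x : 'I_n) : ((x + m) %% n = if x < n - m then x + m else x + m - n)%N.
  have xn := ltn_ord x; case: ifP => le; first by rewrite modn_small //; lia.
  have -> : (x + m = x + m - n + n)%N by lia.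
  by rewrite modnDr modn_small; lia.
have -> : ((a.1 + m) %% n + (a.2 - a.1) < n)%N = ~~ (a.1 < n - m <= a.2)%N.
  rewrite posE; move: (nat_of_ord a.1) (nat_of_ord a.2) lt a1n a2n => u v lt un vn.
  by case: ifP; lia.
case: ifP => // nc.
have sumE : \sum_(g in simple_roots n | (a.1 <= g.1 < a.2)%N) rvec C (CGtau m g) =
    rvec C (turn 1 a.1, turn 1 a.2).
  pose f t := ((t + m) %% n)%N.
  rewrite (sum_simple_roots (f := fun t => unit_row (f t) - unit_row (f t.+1))) //.
    by rewrite (sum_unit_rows f) 1?ltnW // rvecE /= /orbit_pt mul1n.
  move=> g gS lg; have g1 : g \in CG1 n m by rewrite inE gS /label; lia.
  have /eqP eg : g.2 == g.1.+1 :> nat by move: gS; rewrite inE.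
  by rewrite CGtau_turn // rvecE /= eg /orbit_pt mul1n.
case: pickP => [b /andP[bT /eqP eb]|no].
- congr Some; apply: rvec_inj; last by rewrite eb sumE.
    by move: bT; rewrite mem_tilde => /andP[].
  rewrite /rpos /= /orbit_pt mul1n !posE.
  move: (nat_of_ord a.1) (nat_of_ord a.2) lt a1n a2n nc => u v lt un vn nc.
  by do 2!case: ifP; lia.
- have := no (turn 1 a.1, turn 1 a.2); rewrite mem_tilde /= sumE eqxx andbT.
  rewrite /orbit_pt mul1n !posE.
  move: (nat_of_ord a.1) (nat_of_ord a.2) lt a1n a2n nc => u v lt un vn nc.
  by do 2!case: ifP; lia.
Qed.

Lemma tau_powE p (a : rootidx n) : (a.1 < a.2)%N -> tau_pow T p a =
  if clear a.1 (a.2 - a.1) p then Some (turn p a.1, turn p a.2) else None.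
Proof.
move=> lt; have sh q : clear a.1 (a.2 - a.1) q ->
    (pos a.2 q = pos a.1 q + (a.2 - a.1))%N.
  by move/clear_at/(_ (leqnn q)) => /pos_shift; rewrite subnKC // ltnW.
elim: p => [|p IH].
  rewrite /tau_pow /= /fits /= pos0 // (subnKC (ltnW lt)) (ltn_ord a.2) /=.
  by case: a lt {sh} => a1 a2 _; congr (Some (_, _)); apply: val_inj; rewrite /= pos0.
rewrite /tau_pow iterS -/(tau_pow T p a) IH clearS; case: ifP => //= c.
rewrite tau_extE /= sh // addKn pos_pos addn1.
rewrite -[X in (X < _)%N]addn0 ltn_add2l subn_gt0 lt /=; case: ifP => // _.
by congr (Some (_, _)); apply: val_inj; rewrite /= pos_pos addn1.
Qed.

Lemma tau_pow_neg p (a : rootidx n) : ~~ (a.1 < a.2)%N -> tau_pow T p.+1 a = None.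
Proof.
move=> na; rewrite /tau_pow iterSr /= tau_extE (negbTE na) /=.
by elim: p => //= p ->.
Qed.

Lemma tau_powP p (a b : rootidx n) : (0 < p)%N ->
  (tau_pow T p a = Some b) <->
  [/\ pos a.1 p = b.1, (a.1 < a.2)%N, b.2 = b.1 + (a.2 - a.1) :> nat
    & clear a.1 (a.2 - a.1) p]%N.
Proof.
case: p => // p _; case: (boolP (a.1 < a.2)%N) => lt; last first.
  by rewrite tau_pow_neg //; split => // -[].
rewrite tau_powE //; case: ifP => c; last by split => // -[].
have sh : (pos a.2 p.+1 = pos a.1 p.+1 + (a.2 - a.1))%N.
  by move: c => /clear_at/(_ (leqnn _))/pos_shift; rewrite subnKC // ltnW.
split=> [[<-]|[e1 _ e2 _]]; first by rewrite /= sh.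
case: b e1 e2 => [b1 b2] /= e1 e2.
by congr (Some (_, _)); apply: val_inj; rewrite /= ?sh e1.
Qed.

Lemma precE (a b : rootidx n) : prec T a b = precedes n m a.1 a.2 b.1 b.2.
Proof.
apply/asboolP/(preP n_gt0 conm _ _ _ (ltn_ord a.1)) => -[p].
- by case=> p0 /(tau_powP _ _ p0) [e1 lt e2 c]; exists p.
- by case=> p0 e1 lt e2 c; exists p; split=> //; apply/tau_powP.
Qed.

Lemma ordOE (a b : rootidx n) : prec T a b -> ordO T a b = travel n m a.1 b.1.
Proof.
move/asboolP => [p pP]; rewrite /ordO; case: xgetP => [q _ [q0]|/(_ p)]; last by case.
move=> /(tau_powP _ _ q0) [<- lt _ c]; rewrite time_pos //.
by apply: clear_lt c; rewrite ?subn_gt0.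
Qed.

(** Powers of tau translate intervals without reversing them, so the first simple root goes to the
    first one. It is also the last one only at height 1. *)
Lemma rsignE (a b : rootidx n) : prec T a b -> rsign T a b = 1.
Proof.
move=> ab; have := ab; rewrite precE => /(preP n_gt0 conm _ _ _ (ltn_ord a.1)).
case=> p [p0 e1 lt e2 c].
have pn : (p < n)%N by apply: clear_lt c; rewrite ?subn_gt0.
have Op : ordO T a b = p by rewrite ordOE // -e1 time_pos.
have hE : rheight a = (a.2 - a.1)%N by rewrite /rheight; lia.
have simpleE (g : rootidx n) : g \in simple_roots n -> (g.2 = g.1 + 1 :> nat)%N.
  by rewrite inE addn1 => /eqP.
rewrite /rsign; case: ifP => [|_].
  case/and3P=> _ h2 /exists_inP[g gS /exists_inP[h hS /and3P[/eqP eg /eqP eh /eqP]]].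
  rewrite Op => /(tau_powP _ _ p0) [e _ _ _].
  have /simpleE := hS; rewrite -e eg e1 eh e2 => e3.
  by move: h2; rewrite hE; lia.
case: eqVneq => [_|h1]; first by rewrite orbT.
rewrite orbF /prec_right ab hE.
have h2 : (1 < a.2 - a.1)%N by move: h1 lt; rewrite hE; lia.
have a1n : (a.1.+1 < n)%N by have := ltn_ord a.2; lia.
have b1n : (b.1.+1 < n)%N by have := ltn_ord b.2; lia.
rewrite h2 /=; case: exists_inP => // -[].
exists (a.1, Ordinal a1n); first by rewrite inE.
apply/exists_inP; exists (b.1, Ordinal b1n); first by rewrite inE.
rewrite !eqxx /= Op; apply/eqP/tau_powP => //=.
have -> : (a.1.+1 - a.1 = 1)%N by lia.
by split=> //; [lia|apply: clear_le (leqnn p) c; lia].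
Qed.

End Tau.

(** * Entries in the tensor square *)

Local Notation idx i j := (mxtens_index (i, j)).

Lemma matrix_tensP (A : Type) n (M N : 'M[A]_(n * n)) :
  (forall j k i l : 'I_n, M (idx j k) (idx i l) = N (idx j k) (idx i l)) -> M = N.
Proof.
move=> MN; apply/matrixP => I J.
by rewrite -(mxtens_unindexK I) -(mxtens_unindexK J) MN.
Qed.

Lemma sum_tens (V : nmodType) n (F : 'I_(n * n) -> V) :
  \sum_I F I = \sum_(x < n) \sum_(y < n) F (idx x y).
Proof.
rewrite pair_big (reindex (@mxtens_index n n)) /=; last first.
  by exists (@mxtens_unindex n n) => x _; rewrite ?mxtens_indexK ?mxtens_unindexK.
by apply: eq_bigr => -[].
Qed.

Section Entries.
Variables (A : comNzRingType) (n : nat).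
Implicit Types (i j k l : 'I_n) (P : pred (rootidx n * rootidx n)).

Lemma delta_tensE (a b c d j k i l : 'I_n) :
  ((delta_mx a b : 'M[A]_n) *t (delta_mx c d : 'M[A]_n)) (idx j k) (idx i l) =
  [&& j == a, i == b, k == c & l == d]%:R.
Proof. by rewrite tensmxE !mxE -natrM mulnb -andbA. Qed.

Lemma sum_neg_pos P F i j k l :
  (\sum_(ab | P ab) F ab *: (e_neg A ab.1 *t e_pos A ab.2)) (idx j k) (idx i l) =
  if P ((i, j), (k, l)) then F ((i, j), (k, l)) else 0.
Proof.
rewrite summxE big_mkcond (bigD1 ((i, j), (k, l))) //= big1 ?addr0.
  by case: ifP => // _; rewrite mxE delta_tensE !eqxx mulr1.
move=> [[a1 a2] [b1 b2]] /= ne; case: ifP => // _; rewrite mxE delta_tensE /=.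
case: and4P => [[/eqP e1 /eqP e2 /eqP e3 /eqP e4]|_]; last by rewrite mulr0.
by rewrite e1 e2 e3 e4 eqxx in ne.
Qed.

Lemma sum_pos_neg P F i j k l :
  (\sum_(ab | P ab) F ab *: (e_pos A ab.2 *t e_neg A ab.1)) (idx j k) (idx i l) =
  if P ((l, k), (j, i)) then F ((l, k), (j, i)) else 0.
Proof.
rewrite summxE big_mkcond (bigD1 ((l, k), (j, i))) //= big1 ?addr0.
  by case: ifP => // _; rewrite mxE delta_tensE !eqxx mulr1.
move=> [[a1 a2] [b1 b2]] /= ne; case: ifP => // _; rewrite mxE delta_tensE /=.
case: and4P => [[/eqP e1 /eqP e2 /eqP e3 /eqP e4]|_]; last by rewrite mulr0.
by rewrite e1 e2 e3 e4 eqxx in ne.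
Qed.

Lemma sum_diag_tens (c : 'I_n -> 'I_n -> A) i j k l :
  (\sum_(x < n) \sum_(y < n) c x y *: ((delta_mx x x : 'M[A]_n) *t (delta_mx y y : 'M[A]_n)))
    (idx j k) (idx i l) = if (j == i) && (k == l) then c j k else 0.
Proof.
rewrite summxE (bigD1 j) //= summxE (bigD1 k) //= mxE delta_tensE !eqxx /=.
rewrite !big1 ?addr0.
- rewrite [i == j]eq_sym [l == k]eq_sym.
  by case: (j == i) => /=; case: (k == l); rewrite ?mulr1 ?mulr0.
- move=> x /negbTE ne; rewrite summxE big1 // => y _.
  by rewrite mxE delta_tensE [j == x]eq_sym ne mulr0.
- by move=> y /negbTE ne; rewrite mxE delta_tensE [k == y]eq_sym ne /= !andbF mulr0.
Qed.

End Entries.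

(** * Powers of [q] *)

Section Exponential.
Variable C : numFieldType.

Lemma qpowD (x y : C) : qpow x * qpow y = qpow (x + y).
Proof.
apply: fpsP => k /=; rewrite addrC exprDn mulr_suml; apply: eq_bigr => i _.
have lei : (i <= k)%N by rewrite -ltnS.
have nz t : (t`!%:R : C) != 0 by rewrite pnatr_eq0 -lt0n fact_gt0.
rewrite -(bin_fact lei) !natrM -mulr_natr; have := nz i; have := nz (k - i)%N.
have : ('C(k, i)%:R : C) != 0 by rewrite pnatr_eq0 -lt0n bin_gt0.
move: (x ^+ i) (y ^+ (k - i)) => u v c0 i0 ki0; field.
by rewrite c0 i0 ki0.
Qed.

Lemma fps_const0 : fps_const 0 = 0 :> fps C. Proof. by []. Qed.
Lemma fps_constN1 : fps_const (-1) = -1 :> fps C.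
Proof. by apply: fpsP => -[|k] /=; rewrite ?oppr0. Qed.

Lemma qpow_mx_diag d (D : 'rV[C]_d) (I J : 'I_d) :
  qpow_mx (diag_mx D) I J = if I == J then qpow (D 0 I) else 0.
Proof.
have Dk k : (diag_mx D) ^+ k = diag_mx (\row_I D 0 I ^+ k).
  elim: k => [|k IH].
    rewrite expr0 -[1]/(1%:M : 'M_d).
    by apply/matrixP => x y; rewrite !mxE expr0.
  rewrite exprS IH -[_ * _]/(_ *m _) mulmx_diag; congr diag_mx.
  by apply/rowP => x; rewrite !mxE exprS.
apply: fpsP => k; rewrite !mxE /= Dk !mxE; case: eqP => [->|_] /=.
  by rewrite mulr1n.
by rewrite mulr0n mul0r; case: k.
Qed.

End Exponential.

(** * The GGS matrix *)

Section GGS.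
Variables (C : numFieldType) (n m : nat).
Hypotheses (m_gt0 : (0 < m)%N) (ltmn : (m < n)%N) (conm : coprime n m).
Local Notation T := (CG_triple C m_gt0 ltmn conm).
Local Notation r0 := (CG_r0 C n m).
Local Notation pos := (orbit_pt n m).
Local Notation clear := (fits n m).
Local Notation time := (travel n m).
Local Notation pre := (precedes n m).
Implicit Types (i j k l x y : 'I_n).

Let n_gt0 : (0 < n)%N. Proof. exact: ltn_trans ltmn. Qed.
Let n_gt1 : (1 < n)%N. Proof. exact: leq_ltn_trans ltmn. Qed.

(** The two differ on the diagonal, where the residue is [n] and the time is 0; there [CG_r0] is set
    to 0 separately. *)
Lemma Res_time x y : x != y -> Res n ((y%:R - x%:R) / m%:R : 'Z_n) = time x y.
Proof.
move=> ne; have tn := time_lt n_gt0 conm x (ltn_ord y).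
have t0 : time x y != 0%N.
  apply/eqP => e; case/eqP: ne; apply: val_inj.
  by rewrite /= -(pos_time n_gt0 conm x (ltn_ord y)) e pos0.
have -> : (y%:R - x%:R) / m%:R = (time x y)%:R :> 'Z_n.
  rewrite -{1}(pos_time n_gt0 conm x (ltn_ord y)) /orbit_pt Zp_nat_mod // natrD natrM.
  by rewrite addrC addKr mulrK // unitZpE.
by rewrite (Res_nat m_gt0 ltmn) modn_small //; case: (time x y) t0.
Qed.

Definition cg_coef x y : C :=
  if x == y then 0 else 2^-1 - n%:R^-1 * (time x y)%:R.

Lemma r0E j k i l : r0 (idx j k) (idx i l) =
  if (j == i) && (k == l) then cg_coef j k else 0.
Proof.
rewrite (sum_diag_tens (fun x y => if x == y then 0 else
  2^-1 - n%:R^-1 * (Res n ((y%:R - x%:R) / m%:R))%:R)) /cg_coef.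
by case: (_ && _) => //; case: eqVneq => // ne; rewrite Res_time.
Qed.

Lemma r0_diag : r0 = diag_mx (\row_I r0 I I).
Proof.
apply: matrix_tensP => j k i l; rewrite mxE mxE r0E.
rewrite (inj_eq (can_inj (@mxtens_indexK n n))) xpair_eqE.
case: (boolP (_ && _)) => [/andP[/eqP -> /eqP ->]|_]; rewrite ?mulr0n //.
by rewrite r0E !eqxx mulr1n.
Qed.

Lemma ggs_aE j k i l :
  ggs_a T (idx j k) (idx i l) = (pre i j k l)%:R - (pre l k j i)%:R.
Proof.
rewrite /ggs_a (eq_bigr (fun ab : rootidx n * rootidx n =>
    1 *: (e_neg C ab.1 *t e_pos C ab.2) - 1 *: (e_pos C ab.2 *t e_neg C ab.1))).
  rewrite sumrB mxE [X in _ + X]mxE (sum_neg_pos _ (fun=> 1)) (sum_pos_neg _ (fun=> 1)).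
  by rewrite /= !precE /=; do 2!case: (precedes _ _ _ _ _ _).
by move=> ab /rsignE ->; rewrite !scale1r.
Qed.

(** The weight of e_vu (x) e_uv in r_s: multiplication by r_s exchanges the tensor factors with this
    weight. *)
Definition cmp_half (u v : nat) : C := (u < v)%N%:R + 2^-1 * (u == v)%:R.

Lemma cmp_halfC u v : cmp_half u v = 1 - cmp_half v u.
Proof.
rewrite /cmp_half [v == u]eq_sym; by case: (ltngtP u v) => _ /=; field; rewrite ?pnatr_eq0.
Qed.

Lemma ggs_rsE x y i l :
  ggs_rs C n (idx x y) (idx i l) = ((x == l) && (y == i))%:R * cmp_half i l.
Proof.
rewrite /ggs_rs mxE mxE /P0.
have -> : (\sum_(u < n) (delta_mx u u : 'M[C]_n) *t (delta_mx u u : 'M[C]_n)) (idx x y) (idx i l)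
    = [&& x == l, y == i & i == l]%:R.
  rewrite summxE (bigD1 x) //= big1 ?addr0.
    by rewrite delta_tensE eqxx /=; congr (nat_of_bool _)%:R; apply/and3P/and3P;
      case=> /eqP e1 /eqP e2 /eqP e3; rewrite ?e1 ?e2 ?e3 -?e1 -?e2 -?e3 ?eqxx.
  by move=> u /negbTE ne; rewrite delta_tensE [x == u]eq_sym ne.
have -> : (\sum_(a : rootidx n | rpos a) e_neg C a *t e_pos C a) (idx x y) (idx i l)
    = [&& x == l, y == i & (i < l)%N]%:R.
  rewrite summxE big_mkcond (bigD1 (i, x)) //= big1 ?addr0.
    rewrite delta_tensE !eqxx /rpos /=.
    have [->|_] := eqVneq x l; last by rewrite !andbF; case: ifP.
    by rewrite andbT /=; case: (i < l)%N; rewrite ?andbT ?andbF.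
  move=> [a1 a2] ne; case: ifP => // _; rewrite delta_tensE /=.
  case: and4P => // -[/eqP e1 /eqP e2 _ _].
  by rewrite e1 e2 eqxx in ne.
rewrite /cmp_half -[i == l]val_eqE /=.
by case: (x == l); case: (y == i); case: (i < l)%N; case: (i == l :> nat) => /=; ring.
Qed.

Lemma ggs_epsE j k i l : ggs_eps T (idx j k) (idx i l) =
  ((pre l j k i)%:R - (pre i k j l)%:R) * (cmp_half i l - cmp_half k j) +
  \sum_(x < n) \sum_(y < n)
    ((pre x j k y)%:R - (pre y k j x)%:R) * ((pre i x y l)%:R - (pre l y x i)%:R).
Proof.
rewrite /ggs_eps mxE [X in X + _]mxE; congr (_ + _); last first.
  rewrite mxE sum_tens; apply: eq_bigr => x _; apply: eq_bigr => y _.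
  by rewrite !ggs_aE.
have -> : (ggs_a T *m ggs_rs C n) (idx j k) (idx i l) =
    ((pre l j k i)%:R - (pre i k j l)%:R) * cmp_half i l.
  rewrite mxE sum_tens (bigD1 l) //= (bigD1 i) //= ggs_aE ggs_rsE !eqxx mul1r.
  rewrite !big1 ?addr0 // => [x /negbTE ne|y /negbTE ne]; last first.
    by rewrite ggs_rsE ne andbF mul0r mulr0.
  by rewrite big1 // => y _; rewrite ggs_rsE ne mul0r mulr0.
have -> : (ggs_rs C n *m ggs_a T) (idx j k) (idx i l) =
    cmp_half k j * ((pre i k j l)%:R - (pre l j k i)%:R).
  rewrite mxE sum_tens (bigD1 k) //= (bigD1 j) //= ggs_aE ggs_rsE !eqxx mul1r.
  rewrite !big1 ?addr0 // => [x /negbTE ne|y /negbTE ne]; last first.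
    by rewrite ggs_rsE [j == y]eq_sym ne mul0r mul0r.
  by rewrite big1 // => y _; rewrite ggs_rsE [k == x]eq_sym ne andbF mul0r mul0r.
by ring.
Qed.

(** Let P be the flip operator. Under exchange of factors [a] is skew, so aP + Pa = 0, and r_s plus
    its exchange is P, which is [cmp_halfC]. Hence epsilon is symmetric. *)
Lemma ggs_eps_swap j k i l :
  ggs_eps T (idx k j) (idx l i) = ggs_eps T (idx j k) (idx i l).
Proof.
rewrite !ggs_epsE (cmp_halfC l i) (cmp_halfC j k); congr (_ + _); first by ring.
rewrite exchange_big; apply: eq_bigr => x _; apply: eq_bigr => y _; ring.
Qed.

(** [b] and [c] stand for the two relations in the part of epsilon linear in [a]. If [c] holds then
    i < k < l, so the first weight is 1 and only the comparison of [k] with [j] is left; if [b]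
    holds then k < l < j and the second weight is 1. *)
Lemma cmp_half_chain (i j k l : nat) (b c : bool) : (i < j)%N -> (k < l)%N ->
  (b -> (l < j)%N && (k < i)%N) -> (c -> (i < k)%N && (j < l)%N) ->
  (j = k -> c) -> (i = l -> b) ->
  (b%:R - c%:R) * (cmp_half i l - cmp_half k j) =
   - ((c && (j < k)%N)%:R + (b && (l < i)%N)%:R
      + 2^-1 * (j == k)%:R + 2^-1 * (i == l)%:R).
Proof.
move=> ij kl; rewrite /cmp_half; case: b => [/(_ isT) lb|_]; case: c => [/(_ isT) lc|_] jkc ilb;
  case: (ltngtP i l) => il; case: (ltngtP j k) => jk; rewrite ?jk ?il //=;
  try by have := jkc jk.
all: try by have := ilb il.
all: first [exfalso; clear jkc ilb; lia | by field; rewrite ?pnatr_eq0].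
Qed.

Lemma ggs_eps_chain j k i l : pre i j k l -> ggs_eps T (idx j k) (idx i l) =
  - ((time i j < time i k)%N%:R + (n - time i j < time i k)%N%:R
     + 2^-1 * (j == k)%:R + 2^-1 * (i == l)%:R).
Proof.
move=> P; have /(preP n_gt0 conm _ _ _ (ltn_ord i)) [p [p0 ep ij el cP]] := P.
have pn : (p < n)%N by apply: clear_lt cP; rewrite ?subn_gt0.
set s := time i j; have sn : (s < n)%N by apply: time_lt.
have es : pos i s = j by apply: pos_time.
have tp : time i k = p by rewrite -ep time_pos.
have := @count_splittings n m i j k l p s n_gt0 conm ltmn ij p0 ep el cP sn es.
rewrite tp ggs_epsE => /(congr1 (fun t => t%:R : C)).
have kl : (k < l)%N by lia.
have sumE (F : nat -> nat -> bool) :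
    ((\sum_(x < n) \sum_(y < n) F x y)%N%:R : C) = \sum_(x < n) \sum_(y < n) (F x y)%:R.
  by rewrite natr_sum; apply: eq_bigr => x _; rewrite natr_sum.
rewrite !natrD.
rewrite (sumE (fun x y : nat => pre x j k y && pre i x y l)).
rewrite (sumE (fun x y : nat => pre y k j x && pre i x y l)).
rewrite (sumE (fun x y : nat => pre l y x i && pre x j k y)) => e.
rewrite [X in _ + X = _](_ : _ =
    \sum_(x < n) \sum_(y < n) (pre x j k y && pre i x y l)%:R
  - \sum_(x < n) \sum_(y < n) (pre y k j x && pre i x y l)%:R
  - \sum_(x < n) \sum_(y < n) (pre l y x i && pre x j k y)%:R); last first.
  rewrite -!sumrB; apply: eq_bigr => x _; rewrite -!sumrB; apply: eq_bigr => y _.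
  have : ~~ (pre y k j x && pre l y x i).
    by apply/negP => /andP[/and4P[yk _ _ _] /and4P[ly _ _ _]]; lia.
  by case: (pre x j k y) (pre y k j x) (pre i x y l) (pre l y x i) => -[] [] [] //= _; ring.
have lin : ((pre l j k i)%:R - (pre i k j l)%:R) * (cmp_half i l - cmp_half k j) =
   - ((pre i k j l && (j < k)%N)%:R + (pre l j k i && (l < i)%N)%:R
      + 2^-1 * (j == k)%:R + 2^-1 * (i == l)%:R) :> C.
  have P1 : pre l j k i -> (l < j)%N && (k < i)%N.
    by case/and4P=> lj /eqP e' _ _; lia.
  have P2 : pre i k j l -> (i < k)%N && (j < l)%N.
    by case/and4P=> ik /eqP e' _ _; lia.
  apply: cmp_half_chain => //.
  - by move=> e'; move: P; rewrite -e'.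
  - by move=> e'; move: P; rewrite e'.
by move/(canRL (addrK _))/(canRL (addrK _)): e => ->; rewrite lin; ring.
Qed.

End GGS.

(** For s different from p the indicators of s < p and p < s add to 1, and for p + s different from
    n those involving p + s cancel. At s = p or p + s = n a coefficient of [r0] is 0, and the half
    coming from r_s restores the generic total. *)
Lemma r0_arith (C : numFieldType) (p s n : nat) : (0 < n)%N ->
  (s != p)%:R * (2^-1 - n%:R^-1 * (p%:R - s%:R + (p < s)%N%:R * n%:R)) +
  (p + s != n)%N%:R * (2^-1 - n%:R^-1 * (p%:R + s%:R - (n <= p + s)%N%:R * n%:R)) -
  ((s < p)%N%:R + (n < p + s)%N%:R + 2^-1 * (s == p)%:R + 2^-1 * (p + s == n)%N%:R) =
  - (2 * p%:R / n%:R) :> C.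
Proof.
move=> n0; have nz : n%:R != 0 :> C by rewrite pnatr_eq0 -lt0n.
have eqsp : s = p -> s%:R = p%:R :> C by move->.
have eqpsn : (p + s)%N = n -> n%:R = p%:R + s%:R :> C by move<-; rewrite natrD.
move: (p%:R : C) (s%:R : C) (n%:R : C) eqsp eqpsn nz => P S N eqsp eqpsn nz.
have -> : (n <= p + s)%N = (p + s == n)%N || (n < p + s)%N.
  by rewrite leq_eqVlt eq_sym.
case: (ltngtP s p) => [_|_|/eqsp ES]; case: (ltngtP (p + s)%N n) => [_|_|/eqpsn EN] /=;
  rewrite ?EN ?ES; rewrite ?EN ?ES in nz; by field; rewrite ?nz ?pnatr_eq0.
Qed.

(** * The exponent of [q] and the formula for the GGS matrix *)

Section GGS2.
Variables (C : numFieldType) (n m : nat).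
Hypotheses (m_gt0 : (0 < m)%N) (ltmn : (m < n)%N) (conm : coprime n m).
Local Notation T := (CG_triple C m_gt0 ltmn conm).
Local Notation r0 := (CG_r0 C n m).
Local Notation pos := (orbit_pt n m).
Local Notation clear := (fits n m).
Local Notation time := (travel n m).
Local Notation pre := (precedes n m).
Local Notation r0_coef := (cg_coef C m).
Implicit Types (i j k l x y : 'I_n).

Let n_gt0 : (0 < n)%N. Proof. exact: ltn_trans ltmn. Qed.
Let nz : (n%:R : C) != 0. Proof. by rewrite pnatr_eq0 -lt0n. Qed.

Lemma time_eq0 x y : (time x y == 0%N) = (x == y).
Proof.
have xn := ltn_ord x; have yn := ltn_ord y; apply/eqP/eqP => [e|->].
  by apply: val_inj; rewrite /= -(pos_time n_gt0 conm x yn) e pos0.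
by rewrite -{2}(pos0 m yn) time_pos.
Qed.

Lemma r0_coefC x y : r0_coef x y = - r0_coef y x.
Proof.
rewrite /cg_coef eq_sym; case: eqVneq => [|ne]; first by rewrite oppr0.
have xn := ltn_ord x; have yn := ltn_ord y; have tn := time_lt n_gt0 conm x yn.
have -> : time y x = (n - time x y)%N.
  have t0 : (0 < time x y)%N by rewrite lt0n time_eq0 eq_sym.
  have e : pos y (n - time x y) = x.
    rewrite -{1}(pos_time n_gt0 conm x yn) pos_pos subnKC 1?ltnW //.
    by rewrite -(pos_modn n m x n) modnn pos0.
  by rewrite -{1}e time_pos //; lia.
rewrite natrB 1?ltnW //; field; rewrite nz; by [].
Qed.

Lemma r0_eps j k i l : pre i j k l ->
  r0_coef j k + r0_coef i l + ggs_eps T (idx j k) (idx i l) =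
  - (2 * (time i k)%:R / n%:R).
Proof.
move=> P; rewrite ggs_eps_chain // /cg_coef -(time_eq0 j k) -(time_eq0 i l).
have /(preP n_gt0 conm _ _ _ (ltn_ord i)) [p [p0 ep ij el cP]] := P.
have pn : (p < n)%N by apply: clear_lt cP; rewrite ?subn_gt0.
have sn := time_lt n_gt0 conm i (ltn_ord j).
have es := pos_time n_gt0 conm i (ltn_ord j).
have s0 : (0 < time i j)%N by rewrite lt0n time_eq0 -val_eqE /= ltn_eqF.
have -> : time i k = p by rewrite -ep time_pos.
move: (time i j) s0 sn es => s s0 sn es.
have -> : time j k = if (s <= p)%N then (p - s)%N else (p + n - s)%N.
  rewrite -ep -es; case: leqP => sp.
    by rewrite -{1}(subnKC sp) -pos_pos time_pos //; lia.
  rewrite -(pos_modn n m i p) -(modnDr p n) pos_modn.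
  by rewrite -{1}(@subnKC s (p + n)) -1?pos_pos ?time_pos //; lia.
have -> : time i l = if (p + s < n)%N then (p + s)%N else (p + s - n)%N.
  have e : pos i (p + s) = l.
    rewrite addnC -pos_pos es el -ep -(pos_shift (clear_at cP (leqnn p))).
    by rewrite subnKC // ltnW.
  case: ltnP => ps; first by rewrite -{1}e time_pos.
  by rewrite -{1}e -(pos_modn n m i) -(subnK ps) modnDr pos_modn addnK time_pos //; lia.
have -> : (n - s < p)%N = (n < p + s)%N by lia.
have coefE (a : nat) : (if a == 0%N then 0 else 2^-1 - n%:R^-1 * a%:R : C) =
    (a != 0%N)%:R * (2^-1 - n%:R^-1 * a%:R).
  by case: eqP => _ /=; rewrite ?mul0r ?mul1r.
rewrite !coefE {coefE}.
have -> : ((if (s <= p)%N then p - s else p + n - s)%N == 0%N) = (s == p).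
  by case: ifP; lia.
have -> : ((if (p + s < n)%N then p + s else p + s - n)%N == 0%N) = (p + s == n)%N.
  by case: ifP; lia.
have -> : ((if (s <= p)%N then p - s else p + n - s)%N)%:R =
    p%:R - s%:R + (p < s)%N%:R * n%:R :> C.
  case: leqP => sp; first by rewrite natrB // mul0r addr0.
  by rewrite natrB ?natrD ?mul1r; [ring | lia].
have -> : ((if (p + s < n)%N then p + s else p + s - n)%N)%:R =
    p%:R + s%:R - (n <= p + s)%N%:R * n%:R :> C.
  case: ltnP => ps; first by rewrite natrD mul0r subr0.
  by rewrite natrB // natrD mul1r.
exact: r0_arith.
Qed.

Lemma conj_qpow (d : 'I_(n * n) -> C) (X : 'M[fps C]_(n * n)) I J :
  (qpow_mx (diag_mx (\row_K d K)) *m X *m qpow_mx (diag_mx (\row_K d K))) I J =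
  qpow (d I) * X I J * qpow (d J).
Proof.
rewrite mxE (bigD1 J) //= big1 ?addr0 => [|K /negbTE ne]; last first.
  by rewrite qpow_mx_diag ne mulr0.
rewrite qpow_mx_diag eqxx mxE; congr (_ * _).
rewrite mxE (bigD1 I) //= big1 ?addr0 => [|K /negbTE ne]; last first.
  by rewrite qpow_mx_diag eq_sym ne mul0r.
by rewrite qpow_mx_diag eqxx mxE.
Qed.

Lemma conj_atilde : qpow_mx r0 *m ggs_atilde T *m qpow_mx r0 =
  \sum_(ab : rootidx n * rootidx n | prec T ab.1 ab.2)
    qwedge (2 * (ordO T ab.1 ab.2)%:R / n%:R) ab.1 ab.2.
Proof.
apply: matrix_tensP => j k i l.
rewrite (r0_diag C m_gt0 ltmn conm) conj_qpow [ggs_atilde T _ _]mxE !(r0E C m_gt0 ltmn conm) !eqxx /=.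
pose c (ab : rootidx n * rootidx n) : C := 2 * (ordO T ab.1 ab.2)%:R / n%:R.
rewrite (eq_bigr (fun ab : rootidx n * rootidx n =>
    qpow (- c ab) *: (e_neg _ ab.1 *t e_pos _ ab.2)
    - qpow (c ab) *: (e_pos _ ab.2 *t e_neg _ ab.1))); last by [].
pose Q (ab : rootidx n * rootidx n) := prec T ab.1 ab.2.
rewrite sumrB [RHS]mxE [X in _ = _ + X]mxE.
rewrite [X in _ = X - _](@sum_neg_pos (fps C) n Q (fun ab => qpow (- c ab))).
rewrite [X in _ = _ - X](@sum_pos_neg (fps C) n Q (fun ab => qpow (c ab))) /Q.
rewrite /= ggs_aE !precE /=.
case: (boolP (pre i j k l)) => A.
  have /negbTE -> : ~~ pre l k j i.
    by apply/negP => B; case/and4P: A => ? /eqP ? _ _; case/and4P: B => ? /eqP ? _ _; lia.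
  rewrite /= mulr1n mulr0n subr0 [fps_const 1 * _]mul1r mul1r !qpowD subr0 /c /= ordOE ?precE //=.
  by congr qpow; rewrite -(r0_eps A) addrAC.
case: (boolP (pre l k j i)) => B; last first.
  by rewrite /= subrr fps_const0 mul0r mulr0 mul0r subrr.
rewrite /= mulr1n mulr0n !sub0r fps_constN1 !mulN1r mulrN mulNr !qpowD /c /= ordOE ?precE //=.
congr (- qpow _).
(* This entry comes from e_beta (x) e_(-alpha), where [a] is -1. Exchanging the tensor factors fixes
   epsilon and negates both coefficients of [r0], so the exponent is the opposite of the one in
   [r0_eps]. *)
have -> : ggs_eps T (idx j k) (idx i l) = ggs_eps T (idx k j) (idx l i).
  by rewrite ggs_eps_swap.
rewrite (r0_coefC j k) (r0_coefC i l) -[RHS]opprK -(r0_eps B); ring.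
Qed.

Lemma R_GGS_formula : R_GGS T r0 =
  qpow_mx r0 *m R_s C n *m qpow_mx r0 +
    \sum_(ab : rootidx n * rootidx n | prec T ab.1 ab.2)
       qdiff C *: qwedge (2 * (ordO T ab.1 ab.2)%:R / n%:R) ab.1 ab.2.
Proof.
by rewrite /R_GGS mulmxDr mulmxDl -scalemxAr -scalemxAl conj_atilde scaler_sumr.
Qed.

End GGS2.

(** * The equation for [r0] *)

Section Diagonal.
Variables (A : comNzRingType) (n : nat).
Implicit Types (i j k l x y : 'I_n).

Lemma wedge_sumE (c : 'I_n -> 'I_n -> A) j k i l :
  (\sum_x \sum_y c x y *: wedge (delta_mx x x : 'M[A]_n) (delta_mx y y : 'M[A]_n))
    (idx j k) (idx i l) = if (j == i) && (k == l) then c j k - c k j else 0.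
Proof.
rewrite (eq_bigr (fun x => \sum_y c x y *: ((delta_mx x x : 'M[A]_n) *t (delta_mx y y : 'M[A]_n))
  - \sum_y c x y *: ((delta_mx y y : 'M[A]_n) *t (delta_mx x x : 'M[A]_n)))); last first.
  by move=> x _; rewrite -sumrB; apply: eq_bigr => y _; rewrite -scalerBr.
rewrite sumrB [X in _ - X]exchange_big mxE [X in _ + X]mxE.
rewrite (sum_diag_tens (fun x y => c x y)) (sum_diag_tens (fun x y => c y x)).
by case: ifP; rewrite ?subr0.
Qed.

Lemma in_h_wedge_hP (z : 'M[A]_(n * n)) : in_h_wedge_h z ->
  exists w : 'I_n -> 'I_n -> A, (forall x y, w x y = - w y x) /\
  (forall j k i l, z (idx j k) (idx i l) = if (j == i) && (k == l) then w j k else 0).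
Proof.
case=> c ->; exists (fun x y => c x y - c y x); split=> [x y|j k i l].
  by rewrite opprB.
exact: wedge_sumE (fun x y => c x y) j k i l.
Qed.

Lemma P0E j k i l : P0 A n (idx j k) (idx i l) =
  if (j == i) && (k == l) then (j == k)%:R else 0.
Proof.
rewrite summxE (bigD1 j) //= big1 ?addr0.
  rewrite delta_tensE eqxx [i == j]eq_sym; case: eqP => //= ->.
  rewrite [i == k]eq_sym; case: (eqVneq k i) => [->|]; last by case: ifP.
  by rewrite eq_sym; case: ifP.
by move=> u /negbTE ne; rewrite delta_tensE [j == u]eq_sym ne.
Qed.

Lemma contract1E (f : 'rV[A]_n) (z : 'M[A]_(n * n)) (w : 'I_n -> 'I_n -> A) k l :
  (forall j k i l, z (idx j k) (idx i l) = if (j == i) && (k == l) then w j k else 0) ->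
  contract1 f z k l = if k == l then \sum_i f 0 i * w i k else 0.
Proof.
move=> zw; rewrite mxE; case: ifP => kl.
  by apply: eq_bigr => i _; rewrite zw eqxx kl.
by rewrite big1 // => i _; rewrite zw kl andbF mulr0.
Qed.

End Diagonal.

Lemma sum_rvec (C : fieldType) n (a : rootidx n) (w : 'I_n -> C) :
  \sum_i rvec C a 0 i * w i = w a.1 - w a.2.
Proof.
rewrite (eq_bigr (fun i => (i == a.1)%:R * w i - (i == a.2)%:R * w i)); last first.
  by move=> i _; rewrite !mxE !eqxx /= mulrBl.
have one x : \sum_i (i == x)%:R * w i = w x.
  by rewrite (bigD1 x) //= eqxx mul1r big1 ?addr0 // => i /negbTE ->; rewrite mul0r.
by rewrite sumrB !one.
Qed.

Lemma double_sum_nat (C : pzRingType) N :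
  (\sum_(t < N) t%:R) * 2 = N%:R * (N%:R - 1) :> C.
Proof.
elim: N => [|N IH]; first by rewrite big_ord0 !mul0r.
rewrite big_ord_recr /= mulrDl IH -[N.+1]addn1 natrD addrK mulrBr mulr1 mulrDl mul1r.
by rewrite mulr_natr mulr2n addrA subrK.
Qed.

(** * Existence and uniqueness of [r0] *)

Section Solution.
Variables (C : numFieldType) (n m : nat).
Hypotheses (m_gt0 : (0 < m)%N) (ltmn : (m < n)%N) (conm : coprime n m).
Local Notation T := (CG_triple C m_gt0 ltmn conm).
Local Notation r0 := (CG_r0 C n m).
Local Notation pos := (orbit_pt n m).
Local Notation time := (travel n m).
Local Notation r0_coef := (cg_coef C m).
Implicit Types (i j k l x y : 'I_n).

Let n_gt0 : (0 < n)%N. Proof. exact: ltn_trans ltmn. Qed.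
Let nz : (n%:R : C) != 0. Proof. by rewrite pnatr_eq0 -lt0n. Qed.
Local Notation turn := (turn m_gt0 ltmn).

Lemma r0_coef_pos k (t : 'I_n) :
  r0_coef k (turn t k) = if t == 0 :> nat then 0 else 2^-1 - n%:R^-1 * t%:R.
Proof.
by rewrite /cg_coef -(time_eq0 m_gt0 ltmn conm) /= time_pos.
Qed.

(** A rotation of the first index shortens the time to [k] by one. The halves arise where the
    coefficient is set to 0: on arriving at [k], and on leaving it, when the time restarts at n -
    1. *)
Lemma r0_coef_rot x k : r0_coef x k - r0_coef (turn 1 x) k =
  - n%:R^-1 + 2^-1 * ((x == k)%:R + (turn 1 x == k)%:R).
Proof.
rewrite /cg_coef -!(time_eq0 m_gt0 ltmn conm) /=.
have tn := time_lt n_gt0 conm x (ltn_ord k).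
have e := pos_time n_gt0 conm x (ltn_ord k).
case: (time x k) tn e => [|t] tn e.
  have -> : time (pos x 1) k = n.-1.
    rewrite -e -[X in time _ X](pos_modn n m x 0) mod0n.
    have -> : pos x 0 = pos (pos x 1) n.-1.
      by rewrite pos_pos add1n prednK // -(pos_modn n m x n) modnn.
    by rewrite time_pos ?prednK.
  have -> : (n.-1 == 0)%N = false by have := ltmn; have := m_gt0; lia.
  by rewrite -subn1 natrB //=; field; rewrite ?nz ?pnatr_eq0.
have -> : time (pos x 1) k = t.
  by rewrite -e -[t.+1]add1n -pos_pos time_pos //; lia.
rewrite -[t.+1]addn1 natrD; case: t {tn e} => [|t] /=.
  by field; rewrite ?nz ?pnatr_eq0.
by field; rewrite ?nz ?pnatr_eq0.
Qed.

Lemma sum_r0_coef k : \sum_i r0_coef i k = 0.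
Proof.
rewrite (eq_bigr (fun i => - r0_coef k i)); last by move=> i _; rewrite r0_coefC.
pose f (q : 'I_n) := turn q k.
have f_inj : injective f.
  by move=> u v /(congr1 val) /= e; apply: val_inj; apply: (pos_inj conm _ _ e).
rewrite sumrN (reindex_inj f_inj) /=.
rewrite (eq_bigr (fun t : 'I_n => (2^-1 - n%:R^-1 * t%:R) - (t == Ordinal n_gt0)%:R * 2^-1)).
  have one : \sum_(t < n) (t == Ordinal n_gt0)%:R * 2^-1 = 2^-1 :> C.
    rewrite (bigD1 (Ordinal n_gt0)) //= big1 ?addr0 ?eqxx ?mul1r // => i /negbTE ->.
    by rewrite mul0r.
  rewrite sumrB one sumrB -mulr_sumr sumr_const card_ord.
  have := double_sum_nat C n; move: (\sum_(t < n) _) => S e.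
  have -> : S = n%:R * (n%:R - 1) / 2 by rewrite -e mulfK // pnatr_eq0.
  rewrite -mulr_natr; field; by rewrite ?nz ?pnatr_eq0.
move=> t _; rewrite r0_coef_pos -val_eqE /=.
by case: eqP => [->|_] /=; rewrite ?mulr0 ?subr0 ?mul1r ?mul0r ?subrr ?subr0.
Qed.

Definition diff_at (w : 'I_n -> 'I_n -> C) (a : rootidx n) k : C := w a.1 k - w a.2 k.

Lemma r0_equation_diag (z : 'M[C]_(n * n)) (w : 'I_n -> 'I_n -> C) :
  (forall j k i l, z (idx j k) (idx i l) = if (j == i) && (k == l) then w j k else 0) ->
  r0_equation T z <-> forall a k, a \in CG1 n m ->
    diff_at w a k - diff_at w (turn 1 a.1, turn 1 a.2) k =
    2^-1 * (diff_at (fun x y => (x == y)%:R) a k +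
            diff_at (fun x y => (x == y)%:R) (turn 1 a.1, turn 1 a.2) k).
Proof.
move=> zw; have E (a : rootidx n) k l : a \in CG1 n m ->
    contract1 (rvec C a - rvec C (BDtau T a)) z k l = (if k == l then
      diff_at w a k - diff_at w (turn 1 a.1, turn 1 a.2) k else 0) /\
    (2^-1 *: contract1 (rvec C a + rvec C (BDtau T a)) (P0 C n)) k l = if k == l then
      2^-1 * (diff_at (fun x y => (x == y)%:R) a k +
            diff_at (fun x y => (x == y)%:R) (turn 1 a.1, turn 1 a.2) k) else 0.
  move=> aS; rewrite /= (CGtau_turn m_gt0 ltmn conm) //; split.
    rewrite (contract1E _ _ _ zw); case: ifP => // _.
    rewrite (eq_bigr (fun i => rvec C a 0 i * w i k
      - rvec C (turn 1 a.1, turn 1 a.2) 0 i * w i k)).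
      by rewrite sumrB !sum_rvec.
    by move=> i _; rewrite mxE [X in (_ + X) * _]mxE mulrBl.
  rewrite mxE (contract1E _ _ _ (@P0E C n)); case: ifP => _; last by rewrite mulr0.
  congr (_ * _); rewrite (eq_bigr (fun i => rvec C a 0 i * (i == k)%:R
      + rvec C (turn 1 a.1, turn 1 a.2) 0 i * (i == k)%:R)).
    by rewrite big_split /= !sum_rvec.
  by move=> i _; rewrite mxE mulrDl.
split=> [H a k aS|H a aS].
  by have := congr1 (fun M : 'M_n => M k k) (H a aS); have [-> ->] := E a k k aS; rewrite eqxx.
by apply/matrixP => k l; have [-> ->] := E a k l aS; case: ifP => // _; apply: H.
Qed.

Lemma contract1_trace (z : 'M[C]_(n * n)) (w : 'I_n -> 'I_n -> C) :
  (forall j k i l, z (idx j k) (idx i l) = if (j == i) && (k == l) then w j k else 0) ->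
  contract1 (const_mx 1) z = 0 <-> forall k, \sum_i w i k = 0.
Proof.
move=> zw; have E k l : contract1 (const_mx 1) z k l = if k == l then \sum_i w i k else 0.
  rewrite (contract1E _ _ _ zw); case: ifP => // _.
  by apply: eq_bigr => i _; rewrite mxE mul1r.
split=> [H k|H].
  by have := congr1 (fun M : 'M_n => M k k) H; rewrite E eqxx mxE.
by apply/matrixP => k l; rewrite E mxE H; case: ifP.
Qed.

Lemma r0_solves : r0_solution T r0.
Proof.
have r0w := r0E C m_gt0 ltmn conm; split.
- exists (\matrix_(x, y) (2^-1 * r0_coef x y)).
  apply: matrix_tensP => j k i l; rewrite r0w wedge_sumE.
  case: ifP => // _; rewrite !mxE (r0_coefC C m_gt0 ltmn conm k j).
  by field; rewrite ?pnatr_eq0.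
- apply/(r0_equation_diag r0w) => a k _; rewrite /diff_at /=.
  have := r0_coef_rot a.1 k; have := r0_coef_rot a.2 k.
  set u1 := r0_coef a.1 k; set u2 := r0_coef a.2 k.
  set v1 := r0_coef (turn 1 a.1) k; set v2 := r0_coef (turn 1 a.2) k => e2 e1.
  have -> : u1 - u2 - (v1 - v2) = (u1 - v1) - (u2 - v2) by ring.
  by rewrite e1 e2; ring.
- by apply/(contract1_trace r0w) => k; apply: sum_r0_coef.
Qed.

(** The simple roots form one chain alpha_m, alpha_2m, ..., whose last member alpha_(n-m) is the
    only one without a relation to its successor; so all increments of [V] agree. *)
Lemma invariant_arith (V : nat -> C) :
  (forall u, (u.+1 < n)%N -> u.+1 != (n - m)%N ->
    V u - V u.+1 = V (pos u 1) - V (pos u.+1 1)) ->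
  exists d, forall u, (u < n)%N -> V u = V 0%N - u%:R * d.
Proof.
(* For 0 < t < n, [x t] is the first index, counted from 0, of the simple root with label tm modulo
   [n]. *)
move=> H; pose x t := pos n.-1 t.
have xn t : (0 < t < n)%N -> ((x t).+1 < n)%N.
  move=> /andP[t0 tn]; have lt := pos_lt m n_gt0 n.-1 t.
  suff : x t != n.-1 by rewrite /x; lia.
  apply/eqP => e; have n1 : (n.-1 < n)%N by rewrite prednK.
  have : pos n.-1 t = pos n.-1 0 by rewrite -/(x t) e pos0.
  by move/(pos_inj conm tn n_gt0) => e0; rewrite e0 in t0.
have step t : (0 < t)%N -> (t.+1 < n)%N ->
    V (x t) - V (x t).+1 = V (x t.+1) - V (x t.+1).+1.
  move=> t0 tn; have xt := xn t _; have xt1 := xn t.+1 _.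
  have e : pos (x t) 1 = x t.+1 by rewrite /x pos_pos addn1.
  rewrite H ?xt ?t0 ?(ltnW tn) // ?e.
    congr (_ - V _); rewrite -addn1 pos_shift ?e ?addn1 //.
    by apply: xt1; rewrite tn.
  apply/eqP => ex; have := xt1; rewrite -e /orbit_pt mul1n.
  have -> : (x t + m = n.-1)%N by have := ltmn; lia.
  by rewrite modn_small ?prednK // ltnn => /(_ tn).
have const t : (0 < t < n)%N -> V (x t) - V (x t).+1 = V (x 1) - V (x 1).+1.
  case: t => // t; elim: t => // t IH /andP[_ tn].
  by rewrite -step // IH //= ltnW.
exists (V (x 1) - V (x 1).+1); elim=> [|u IH] un; first by rewrite mul0r subr0.
have tn := time_lt n_gt0 conm n.-1 (ltnW un).
have et := pos_time n_gt0 conm n.-1 (ltnW un).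
have := const (time n.-1 u); rewrite /x et tn andbT.
have -> : (0 < time n.-1 u)%N.
  rewrite lt0n; apply/eqP => e; move: et; rewrite e pos0 ?prednK // => e'.
  by move: un; rewrite -e' prednK // ltnn.
move=> /(_ isT) e; rewrite -[u.+1]addn1 natrD mulrDl mul1r opprD addrA -IH 1?ltnW //.
by rewrite addn1 -/(x 1) -e; ring.
Qed.

Lemma r0_unique (r : 'M[C]_(n * n)) : r0_solution T r -> r = r0.
Proof.
have r0w := r0E C m_gt0 ltmn conm.
case=> /in_h_wedge_hP [w [skew rw]] /(r0_equation_diag rw) eqr /(contract1_trace rw) trr.
have [_ /(r0_equation_diag r0w) eq0 /(contract1_trace r0w) tr0] := r0_solves.
pose v x k := w x k - r0_coef x k.
have vskew x k : v x k = - v k x.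
  by rewrite /v skew (r0_coefC C m_gt0 ltmn conm x k); ring.
have vtr k : \sum_i v i k = 0 by rewrite sumrB trr tr0 subrr.
have veq (a : rootidx n) k : a \in CG1 n m ->
    v a.1 k - v a.2 k = v (turn 1 a.1) k - v (turn 1 a.2) k.
  move=> aS; have := eqr a k aS; rewrite -(eq0 a k aS) /diff_at /v /= => /eqP.
  rewrite -subr_eq0 => /eqP e; apply/eqP; rewrite -subr_eq0; apply/eqP.
  by rewrite -[RHS]e; ring.
(* An affine function on 0, ..., n - 1 with sum zero vanishes at the centre (n - 1)/2. *)
have key k : exists d, forall x, v x k * 2 = d * (n%:R - 1 - x%:R * 2).
  pose V u := v (odflt k (insub u)) k.
  have VE x : V x = v x k by rewrite /V valK.
  have VO u (un : (u < n)%N) : V u = v (Ordinal un) k by rewrite -VE.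
  have [|d Vd] := @invariant_arith V.
    move=> u un ne; have un' := ltnW un.
    have := veq (Ordinal un', Ordinal un) k; rewrite /= !inE /label /= eqxx ne => /(_ isT).
    by rewrite -!VE /=.
  have V0 : n%:R * V 0%N * 2 = n%:R * ((n%:R - 1) * d).
    have := vtr k; rewrite (eq_bigr (fun x : 'I_n => V 0%N - x%:R * d)).
      rewrite sumrB sumr_const card_ord -mulr_suml => /eqP.
      by rewrite subr_eq0 mulr_natl => /eqP ->; rewrite mulrAC double_sum_nat; ring.
    by move=> x _; rewrite -VE Vd.
  exists d => x; rewrite -VE Vd // mulrBl.
  have -> : V 0%N * 2 = (n%:R - 1) * d by apply: (mulfI nz); rewrite mulrA.
  by ring.
have two : 2 != 0 :> C by rewrite pnatr_eq0.
have v0 x k : v x k = 0.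
  have [d dE] := key k; apply: (mulIf two); rewrite mul0r dE.
  have : d * (n%:R - 1 - k%:R * 2) = 0.
    rewrite -dE; have : v k k + v k k = 0 by rewrite {1}vskew addNr.
    by rewrite mulr_natr mulr2n.
  (* The diagonal value 0 forces the slope to vanish unless 2k = n - 1. For that middle index,
     [v k x] is 0 by the affine formula in its first argument, and skew-symmetry gives [v x k]. *)
  move/eqP; rewrite mulf_eq0 => /orP[/eqP -> |/eqP k0]; first by rewrite mul0r.
  have [d' dE'] := key x; rewrite -dE vskew mulNr dE' k0 mulr0 oppr0 //.
apply: matrix_tensP => j k i l; rewrite rw r0w; case: ifP => // _.
by apply/eqP; rewrite -subr_eq0 -/(v j k) v0.
Qed.

End Solution.

Local Open Scope complex_scope.

Theorem proposition1p4 (R : realType) (n m : nat)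
    (m_gt0 : (0 < m)%N) (ltmn : (m < n)%N) (conm : coprime n m) :
  let T := CG_triple R[i] m_gt0 ltmn conm in
  let r0 := CG_r0 R[i] n m in
  (forall r : 'M[R[i]]_(n * n), r0_solution T r <-> r = r0) /\
  R_GGS T r0 =
    qpow_mx r0 *m R_s R[i] n *m qpow_mx r0 +
    \sum_(ab : rootidx n * rootidx n | prec T ab.1 ab.2)
       qdiff R[i] *:
         qwedge (2 * (ordO T ab.1 ab.2)%:R / n%:R) ab.1 ab.2.
Proof.
move=> T r0; split; last exact: R_GGS_formula.
by move=> r; split=> [/r0_unique|->]; [apply | apply: r0_solves].
Qed.
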